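(* Consider the elephant random walk $(S_n)$ with two memory channels and memory parameter $p\in(0,1)$. (i) If $11/16<p<1$, then $|S_n|\to\infty$ almost surely and $$\lim_{n\to\infty}\frac{\log|S_n|}{\log n}=\min\left\{\frac{8p-4}{3},1\right\}\quad\text{almost surely}.$$ (ii) If $11/16<p<7/8$, then there is a finite random variable $L_p$ such that $$\frac{S_n}{n^{(8p-4)/3}}\longrightarrow L_p\quad\text{almost surely},\qquad \mathbb{P}(L_p=0)=0.$$
   Context: Model (elephant random walk with two memory channels, memory parameter $p\in(0,1)$): $S_0=0$; $X_1,X_2$ are independent random signs, each equal to $1$ or $-1$ with probability $1/2$. For $n\ge2$ choose, independently of the past and independently for different $n$, indices $U_{1,n+1},U_{2,n+1}$ i.i.d. uniform on $\{1,\ldots,n\}$ and signs $\sigma_{1,n+1},\sigma_{2,n+1}\in\{-1,1\}$, independent of each other and of the indices, with $\mathbb{P}(\sigma_{i,n+1}=1)=p$, $\mathbb{P}(\sigma_{i,n+1}=-1)=1-p$. Put $Y_{i,n+1}=\sigma_{i,n+1}X_{U_{i,n+1}}$ for $i=1,2$, and $X_{n+1}=\operatorname{sgn}(Y_{1,n+1}+Y_{2,n+1})$ with $\operatorname{sgn}(0)=0$. The position is $S_n=\sum_{j=1}^nX_j$. *)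

(* Defs.v *)
From HB Require Import structures.
From mathcomp Require Import all_boot all_order all_algebra finmap.
From mathcomp Require Import all_classical all_reals all_analysis.
Import Order.TTheory GRing.Theory Num.Theory.
Import numFieldNormedType.Exports.

Set Implicit Arguments.
Unset Strict Implicit.
Unset Printing Implicit Defensive.

Local Open Scope classical_set_scope.
Local Open Scope ring_scope.

Definition sigma_of d d' (T : measurableType d) (T' : measurableType d')
  (X : T -> T') : set (set T) := preimage_set_system setT X measurable.

(* [F] is a family of sub-sigma-algebras, so that random variables with values
   in different spaces can be declared jointly independent. *)
Definition mutually_independent d (T : measurableType d) (R : realType)
    (P : probability T R) (I : choiceType) (F : I -> set (set T)) : Prop :=
  forall (J : {fset I}) (A : I -> set T),
    (forall i, i \in J -> F i (A i)) ->
    fine (P (\bigcap_(i in [set` J]) A i)) = \prod_(i <- J) fine (P (A i)).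

Section elephant_random_walk.
Context {d} {T : measurableType d} {R : realType} (P : probability T R).
Variables (X : nat -> {RV P >-> R})
  (U : 'I_2 -> nat -> {RV P >-> nat}) (sigma : 'I_2 -> nat -> {RV P >-> R}).

(* The channels are indexed by ['I_2]; times start at 1, so [X 0] and the
   values of [U i] and [sigma i] at times 0, 1, 2 play no role. *)
Definition recalled (i : 'I_2) (n : nat) (w : T) : R :=
  sigma i n w * X (U i n w) w.

(* The sources of randomness: [X 1], [X 2], and the draws made at the times
   [n.+3], i.e. at all times at least 3. *)
Definition source_sigma (s : 'I_2 + ('I_2 * nat) + ('I_2 * nat)) :
    set (set T) :=
  match s with
  | inl (inl k) => sigma_of (X k.+1)
  | inl (inr (i, n)) => sigma_of (U i n.+3)
  | inr (i, n) => sigma_of (sigma i n.+3)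
  end.

Record elephant_walk (p : R) : Prop := ElephantWalk {
  first_steps_law : forall k : 'I_2,
    P (X k.+1 @^-1` [set 1]) = (2^-1)%:E /\
    P (X k.+1 @^-1` [set -1]) = (2^-1)%:E ;
  index_law : forall (i : 'I_2) (n k : nat), (2 <= n)%N -> (1 <= k <= n)%N ->
    P (U i n.+1 @^-1` [set k]) = (n%:R^-1)%:E ;
  sign_law : forall (i : 'I_2) (n : nat), (2 <= n)%N ->
    P (sigma i n.+1 @^-1` [set 1]) = p%:E /\
    P (sigma i n.+1 @^-1` [set -1]) = (1 - p)%:E ;
  sources_independent : mutually_independent P source_sigma ;
  step_eq : forall (n : nat) (w : T), (2 <= n)%N ->
    X n.+1 w = Num.sg (\sum_(i < 2) recalled i n.+1 w)
}.

Definition position (n : nat) (w : T) : R := \sum_(1 <= j < n.+1) X j w.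

End elephant_random_walk.

(* Main.v *)
Require Import Defs.
From HB Require Import structures.
From mathcomp Require Import all_boot all_order all_algebra finmap.
From mathcomp Require Import all_classical all_reals all_analysis.
From mathcomp Require Import measurable_realfun ring lra.
Import Order.TTheory GRing.Theory Num.Theory.
Import numFieldNormedType.Exports.

(** Write [q = 2 p - 1], let [Z] be the number of non-zero steps up to time [n],
    and put [z = Z / n] and [s = S / n]. Given the past, a recalled step is 1 or -1
    with probabilities [(z + q s) / 2] and [(z - q s) / 2], so the next step has mean
    [q (2 - z) s] and second moment [2 z - 3 z^2 / 2 + q^2 s^2 / 2]. In logarithmic time
    the pair [(z, s)] thus follows a noisy version of
    [z' = z - 3 z^2 / 2 + q^2 s^2 / 2] and [s' = (q (2 - z) - 1) s].
    Near [s = 0] the frequency [z] is attracted by [2 / 3], where the position grows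
    like [n^a] with [a = 4 q / 3 = (8 p - 4) / 3]. The condition [p > 11 / 16] says
    that [a > 1 / 2], so that the drift beats the diffusion, and [p < 7 / 8] that
    [a < 1].

    Letters form a finite alphabet and the law of the next step is an explicit
    function of the history ([chain_rule], from the independence of the sources), so
    conditional expectations are finite sums. The only probabilistic tool is Ville's
    inequality for non-negative functions of the history that decrease in the mean
    ([ville]). Three potentials are used. The first one shows that a martingale
    transform with summable conditional variances converges ([transform_cvg]). The
    second one, close to [1 / z] while [z < 1 / 3], shows that [z] does not tend to 0
    ([ae_active]). The third one, [n^c / (K + S^2 / n)] with a small exponent [c],
    shows that [S^2] eventually exceeds a multiple of [n^(1 + c)] ([ae_escaped]).
    This last fact is what excludes a vanishing limit: the walk leaves the
    diffusive scale for good, so its logarithm makes sense and has convergent noise,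
    and the limit of [S / n^a] is, up to a sign, the exponential of a finite number.

    The rest is an analysis of a single path. The noise series converge, hence [z] is
    eventually at least about [2 / 3], and [s] tends to 0 and [z] to [2 / 3] when
    [q < 3 / 4]. Summing relative increments expresses [ln |S|], [ln Z] and [ln n],
    up to convergent terms, as sums over [k < n] of rates divided by [k]. In the
    combination [ln |S| - (2 q / 3) ln Z - (2 q / 3) ln n] the variable [z] cancels and
    only the sum of [- (q^3 / 3) s^2 / z] remains ([balance_cvg]). When [q < 3 / 4] this
    sum converges, which gives the limit of [S / n^a] and the exponent [a]
    ([pos_scale_cvg]). When [q >= 3 / 4] it is small as long as [s] is small, so that
    [|S|] cannot stay below [n^(1 - e)] ([ln_pos_lower]), while [|S| <= n]. *)

Set Implicit Arguments.
Unset Strict Implicit.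
Unset Printing Implicit Defensive.

Local Open Scope classical_set_scope.
Local Open Scope ring_scope.

(** * Real-valued probabilities *)

Section real_probability.
Context {d} {T : measurableType d} {R : realType} (P : probability T R).

Definition pr (E : set T) : R := fine (P E).

Lemma prE E : measurable E -> P E = (pr E)%:E.
Proof. by move=> mE; rewrite /pr fineK// fin_num_measure. Qed.

Lemma pr_ge0 E : 0 <= pr E.
Proof. by rewrite /pr fine_ge0. Qed.

Lemma pr_setT : pr setT = 1.
Proof. by rewrite /pr probability_setT. Qed.

Lemma pr_set0 : pr set0 = 0.
Proof. by rewrite /pr measure0. Qed.

Lemma le_pr E F : measurable E -> measurable F -> E `<=` F -> pr E <= pr F.
Proof.
by move=> mE mF EF; rewrite -lee_fin -!prE//; apply: le_measure => //; rewrite inE.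
Qed.

Lemma prU E F : measurable E -> measurable F -> E `&` F = set0 ->
  pr (E `|` F) = pr E + pr F.
Proof.
move=> mE mF EF; apply: EFin_inj; rewrite -prE ?EFinD ?measureU//.
  by rewrite -!prE.
exact: measurableU.
Qed.

Lemma pr_seq (I : eqType) (X : T -> I) E (s : seq I) :
  (forall i, measurable (X @^-1` [set i])) -> measurable E -> uniq s ->
  measurable (E `&` X @^-1` [set` s]) /\
  pr (E `&` X @^-1` [set` s]) = \sum_(i <- s) pr (E `&` X @^-1` [set i]).
Proof.
move=> mX mE; elim: s => [|i s IH] /=.
  by move=> _; rewrite big_nil set_nil preimage_set0 setI0 pr_set0.
case/andP => nis us; have [mS eS] := IH us.
have -> : X @^-1` [set` i :: s] = X @^-1` [set i] `|` X @^-1` [set` s].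
  apply/seteqP; split=> w /=; rewrite inE; first by case/orP => [/eqP|]; [left|right].
  by case=> [->|->]; rewrite ?eqxx ?orbT.
rewrite big_cons -eS setIUr; split.
  by apply: measurableU => //; apply: measurableI.
rewrite prU//; first exact: measurableI.
rewrite -subset0 => w [[_ /= Xi] [_ /= Xs]].
by move: nis; rewrite -Xi Xs.
Qed.

Lemma pr_partition (I : finType) (X : T -> I) E :
  (forall i, measurable (X @^-1` [set i])) -> measurable E ->
  pr E = \sum_i pr (E `&` X @^-1` [set i]).
Proof.
move=> mX mE.
rewrite -(proj2 (pr_seq mX mE (index_enum_uniq I))); congr pr.
by apply/seteqP; split=> [w Ew|w []//]; split => //=; rewrite mem_index_enum.
Qed.

(** The event [F] stands in for the complement of [Q], which need not be measurable. *)
Lemma ae_of_small (Q : T -> Prop) :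
  (forall e : R, 0 < e -> exists2 F, measurable F &
     pr F <= e /\ forall w, ~ Q w -> F w) -> {ae P, forall w, Q w}.
Proof.
move=> H; have {}H n : exists F : set T, [/\ measurable F, pr F <= n.+1%:R^-1 &
    forall w, ~ Q w -> F w].
  have [|F mF [pF QF]] := H n.+1%:R^-1; first by rewrite invr_gt0.
  by exists F.
have [F HF] := choice H.
exists (\bigcap_n F n); split.
- by apply: bigcap_measurable => // n _; case: (HF n).
- have mI : measurable (\bigcap_n F n).
    by apply: bigcap_measurable => // n _; case: (HF n).
  rewrite prE//; congr EFin; apply/eqP; rewrite eq_le pr_ge0 andbT.
  apply/ler_addgt0Pl => e e0; rewrite addr0.
  have [n ne] : exists n, n.+1%:R^-1 < e.
    have [n _ /(_ n (leqnn n))] := near_infty_natSinv_lt (PosNum e0).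
    by exists n.
  apply: le_trans (ltW ne); have [mF pF _] := HF n; apply: le_trans pF.
  by apply: le_pr => // w; apply.
- by move=> w /= nQ n _; case: (HF n) => _ _; apply.
Qed.

Lemma pr_bigcup_le (F : nat -> set T) c : (forall n, measurable (F n)) ->
  (forall n, F n `<=` F n.+1) -> (forall n, pr (F n) <= c) ->
  pr (\bigcup_n F n) <= c.
Proof.
move=> mF ndF Fc.
have mU : measurable (\bigcup_n F n) by exact: bigcup_measurable.
have cv := @nondecreasing_cvg_mu _ _ _ P F mF mU.
have : P (F n) @[n --> \oo] --> P (\bigcup_n F n).
  apply: cv; apply/nondecreasing_seqP => n; exact/subsetPset.
move=> cvU; rewrite -lee_fin -prE//.
rewrite -(cvg_lim _ cvU)//; apply: lime_le; first by apply/cvg_ex; eexists; exact: cvU.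
by apply: nearW => n; rewrite prE// lee_fin.
Qed.

End real_probability.

(** * Supermartingales along the history of a finite-letter process *)

Section chain.
Context {d} {T : measurableType d} {R : realType} (P : probability T R).
Context {A : finType} (a0 : A) (l : nat -> T -> A) (K : seq A -> A -> R) (n0 : nat).
Hypothesis ml : forall n a, measurable (l n @^-1` [set a]).

Definition hist n w : seq A := mkseq (l ^~ w) n.

(** The elementary event that the first [size h] letters are exactly [h]. As the
    alphabet is finite, these events carry the whole conditional structure: a
    conditional expectation is the finite sum [mean]. *)
Definition atom (h : seq A) : set T := hist (size h) @^-1` [set h].

Definition mean (h : seq A) (f : A -> R) : R := \sum_a K h a * f a.

Hypothesis chain_rule : forall h a, (n0 <= size h)%N ->
  pr P (atom (rcons h a)) = pr P (atom h) * K h a.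

(** Conditioning on an atom is meaningful only when its probability is non-zero;
    null atoms are where a supermartingale may fail to decrease in the mean. *)
Definition charged h := pr P (atom h) != 0.

Lemma size_hist n w : size (hist n w) = n.
Proof. by rewrite size_mkseq. Qed.

Lemma histS n w : hist n.+1 w = rcons (hist n w) (l n w).
Proof. by rewrite /hist mkseqS. Qed.

Lemma take_hist k n w : (k <= n)%N -> take k (hist n w) = hist k w.
Proof. by move=> kn; rewrite /hist /mkseq -map_take take_iota (minn_idPl kn). Qed.

Lemma nth_hist k n w : (k < n)%N -> nth a0 (hist n w) k = l k w.
Proof. by move=> kn; rewrite nth_mkseq. Qed.

Lemma measurable_hist n (B : set (seq A)) : measurable (hist n @^-1` B).
Proof.
elim: n B => [|n IH] B.
  have [B0|B0] := pselect (B [::]).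
    by rewrite (_ : _ @^-1` _ = setT)//; apply/seteqP; split.
  by rewrite (_ : _ @^-1` _ = set0)//; apply/seteqP; split.
rewrite (_ : _ @^-1` _ = \bigcup_(a in [set: A])
    (hist n @^-1` [set h | B (rcons h a)] `&` l n @^-1` [set a])).
  by apply: fin_bigcup_measurable => // a _; apply: measurableI.
apply/seteqP; split=> w /=; rewrite histS; first by exists (l n w).
by case=> a _ [/= Ba ->].
Qed.

Lemma measurable_atom h : measurable (atom h).
Proof. exact: measurable_hist. Qed.
#[local] Hint Resolve measurable_hist measurable_atom : core.

Lemma atom_rcons h a : atom (rcons h a) = atom h `&` l (size h) @^-1` [set a].
Proof.
apply/seteqP; split=> w; rewrite /atom /= size_rcons histS.
  by move=> /rcons_inj[-> ->].
by case=> /= -> ->.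
Qed.

Lemma pr_atomE h E : measurable E ->
  pr P (atom h `&` E) = \sum_a pr P (atom (rcons h a) `&` E).
Proof.
move=> mE; rewrite (pr_partition P (X := l (size h)))//; last exact: measurableI.
by apply: eq_bigr => a _; rewrite atom_rcons setIAC.
Qed.

Lemma pr_atom_sum h : pr P (atom h) = \sum_a pr P (atom (rcons h a)).
Proof.
rewrite -(setIT (atom h)) pr_atomE//.
by apply: eq_bigr => a _; rewrite setIT.
Qed.

Lemma pr_atom_eq0 h E : measurable E -> ~~ charged h -> pr P (atom h `&` E) = 0.
Proof.
rewrite /charged negbK => mE /eqP h0; apply/eqP; rewrite eq_le pr_ge0 andbT -h0.
by apply: le_pr => //; apply: measurableI.
Qed.

Lemma kernel_ge0 h a : (n0 <= size h)%N -> charged h -> 0 <= K h a.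
Proof.
move=> nh; rewrite /charged => h0; have := pr_ge0 P (atom (rcons h a)).
by rewrite chain_rule// pmulr_rge0// lt_neqAle eq_sym h0 pr_ge0.
Qed.

Lemma kernel_sum1 h : (n0 <= size h)%N -> charged h -> \sum_a K h a = 1.
Proof.
move=> nh; rewrite /charged => h0; apply: (mulfI h0); rewrite mulr1 mulr_sumr.
by rewrite [RHS]pr_atom_sum; apply: eq_bigr => a _; rewrite chain_rule.
Qed.

Lemma meanD h f g : mean h (fun a => f a + g a) = mean h f + mean h g.
Proof. by rewrite /mean -big_split/=; apply: eq_bigr => a _; rewrite mulrDr. Qed.

Lemma meanZ h c f : mean h (fun a => c * f a) = c * mean h f.
Proof. by rewrite /mean mulr_sumr; apply: eq_bigr => a _; rewrite mulrCA. Qed.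

Lemma mean_cst h c : (n0 <= size h)%N -> charged h -> mean h (fun=> c) = c.
Proof. by move=> nh ch; rewrite /mean -mulr_suml kernel_sum1// mul1r. Qed.

Lemma le_mean h f g : (n0 <= size h)%N -> charged h -> (forall a, f a <= g a) ->
  mean h f <= mean h g.
Proof.
by move=> nh ch fg; apply: ler_sum => a _; rewrite ler_wpM2l// kernel_ge0.
Qed.

Definition supermartingale N (V : seq A -> R) := forall h, (N <= size h)%N ->
  charged h -> mean h (fun a => V (rcons h a)) <= V h.

Definition crossing N m (V : seq A -> R) (c : R) : set T :=
  [set w | exists2 k, (k <= m)%N & c <= V (hist (N + k) w)].

Lemma measurable_crossing N m (V : seq A -> R) (c : R) : measurable (crossing N m V c).
Proof.
rewrite (_ : crossing N m V c = hist (N + m) @^-1`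
   [set g | exists2 k, (k <= m)%N & c <= V (take (N + k) g)])//.
apply/seteqP; split=> w [k km /= H]; exists k => //.
  by rewrite take_hist// leq_add2l.
by rewrite take_hist// leq_add2l in H.
Qed.
#[local] Hint Resolve measurable_crossing : core.

(** Backward induction on the horizon: either [h] is already above the level
    [c], so that [V h / c] is at least 1, or the first letter is played and the
    chain rule averages the bounds obtained for the children of [h], the average
    being at most [V h / c] by the supermartingale property. *)
Lemma pr_crossing_atom N m (V : seq A -> R) (c : R) h :
  (n0 <= N)%N -> 0 < c -> (forall g, 0 <= V g) ->
  supermartingale N V -> (N <= size h)%N ->
  pr P (atom h `&` crossing (size h) m V c) <= pr P (atom h) * (V h / c).
Proof.
move=> nN c0 V0 sV; elim: m h => [|m IH] h Nh.
all: have [ch|/pr_atom_eq0 -> //] := boolP (charged h);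
  last by rewrite mulr_ge0 ?pr_ge0// divr_ge0// ltW.
all: have [cV|Vc] := leP c (V h); first by
  apply: (le_trans (y := pr P (atom h)));
  [by apply: le_pr => //; apply: measurableI
  |rewrite ler_peMr ?pr_ge0// ler_pdivlMr// mul1r].
  rewrite (_ : _ `&` _ = set0) ?pr_set0 ?mulr_ge0 ?pr_ge0 ?invr_ge0 ?(ltW c0)//.
  apply/seteqP; split=> // w [/= hw [k]]; rewrite leqn0 => /eqP ->.
  by rewrite addn0 hw leNgt Vc.
rewrite pr_atomE//; apply: (@le_trans _ _
   (\sum_a pr P (atom (rcons h a)) * (V (rcons h a) / c))).
  apply: ler_sum => a _; apply: le_trans (IH (rcons h a) _); last first.
    by rewrite size_rcons leqW.
  apply: le_pr; [exact: measurableI|exact: measurableI|].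
  move=> w [ha [k km kV]]; split=> //.
  case: k => [|k] in km kV *; last by
    exists k => //; rewrite size_rcons addSnnS.
  move: ha kV; rewrite atom_rcons addn0 => -[/= -> _].
  by rewrite leNgt Vc.
rewrite (eq_bigr (fun a => pr P (atom h) / c * (K h a * V (rcons h a)))); last first.
  by move=> a _; rewrite chain_rule ?(leq_trans nN)//; lra.
rewrite -mulr_sumr mulrAC [leRHS]mulrA ler_wpM2r ?invr_ge0 ?(ltW c0)//.
by rewrite ler_wpM2l ?pr_ge0//; apply: sV.
Qed.

(** The bounds below the atoms of length [N] are added up along the tree of
    histories, down to the empty history, whose atom is the whole space. *)
Lemma pr_crossing N m (V : seq A -> R) (c C : R) :
  (n0 <= N)%N -> 0 < c -> (forall g, 0 <= V g) ->
  supermartingale N V -> (forall h, size h = N -> V h <= C) ->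
  pr P (crossing N m V c) <= C / c.
Proof.
move=> nN c0 V0 sV VC.
suff H i : forall h, (size h + i)%N = N ->
    pr P (atom h `&` crossing N m V c) <= pr P (atom h) * (C / c).
  have := H N [::] erefl; rewrite (_ : atom [::] = setT).
    by rewrite setTI pr_setT mul1r.
  by apply/seteqP; split.
elim: i => [|i IH] h hN.
  rewrite addn0 in hN.
  apply: le_trans (_ : pr P (atom h) * (V h / c) <= _).
    by rewrite -{1}hN; apply: (pr_crossing_atom _ nN) => //; rewrite hN.
  by rewrite ler_wpM2l ?pr_ge0// ler_wpM2r ?invr_ge0 ?(ltW c0)// VC.
rewrite pr_atomE// -[X in _ <= pr P X * _]setIT pr_atomE// mulr_suml.
apply: ler_sum => a _; rewrite setIT; apply: IH.
by rewrite size_rcons -hN addnS.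
Qed.

(** Ville's maximal inequality; the horizon of [pr_crossing] is sent to infinity. *)
Lemma ville N (V : seq A -> R) (c C : R) : (n0 <= N)%N -> 0 < c -> (forall g, 0 <= V g) ->
  supermartingale N V -> (forall h, size h = N -> V h <= C) ->
  pr P (\bigcup_m crossing N m V c) <= C / c.
Proof.
move=> nN c0 V0 sV VC; apply: pr_bigcup_le => [n|n w [k kn cV]|n] //.
  by exists k => //; apply: leqW.
exact: pr_crossing.
Qed.

Lemma bounded_on_size (V : seq A -> R) N : exists C, forall h, size h = N -> V h <= C.
Proof.
elim: N V => [|N IH] V.
  by exists (V [::]) => h /size0nil ->.
have H a : exists C, forall h, size h = N -> V (a :: h) <= C by exact: IH.
have [C HC] := choice H.
exists (\sum_a `|C a|) => -[//|a h] /= [hN]; apply: le_trans (HC a h hN) _.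
rewrite (bigD1 a)//=; apply: le_trans (ler_norm _) _.
by rewrite lerDl sumr_ge0.
Qed.

(** The probability of ever exceeding a level tends to 0 as the level grows.
    Potentials that would blow up along undesired paths thus exclude these
    paths. *)
Lemma supermartingale_bounded N (V : seq A -> R) : (n0 <= N)%N -> (forall g, 0 <= V g) ->
  supermartingale N V ->
  {ae P, forall w, exists B, forall n, (N <= n)%N -> V (hist n w) <= B}.
Proof.
move=> nN V0 sV; have [C HC] := bounded_on_size V N.
apply: ae_of_small => e e0.
exists (\bigcup_m crossing N m V ((`|C| + 1) / e)).
  exact: bigcup_measurable.
have c0 : 0 < (`|C| + 1) / e by rewrite divr_gt0// ltr_wpDl.
split=> [|w nB].
  apply: le_trans (ville nN c0 V0 sV HC) _.
  have := ler_norm C => ?.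
  by rewrite invf_div mulrA ler_pdivrMr ?ltr_wpDl// mulrC ler_pM2l//; lra.
apply: contrapT => nc; apply: nB; exists ((`|C| + 1) / e) => n Nn.
rewrite leNgt; apply/negP => H; apply: nc; exists (n - N)%N => //; exists (n - N)%N => //.
by rewrite subnKC// ltW.
Qed.

End chain.

(** * Martingale transforms *)

Lemma cvgn_of_cauchy (R : realType) (u : nat -> R) :
  (forall j : nat, exists N, forall n, (N <= n)%N -> `|u n - u N| < j.+1%:R^-1) ->
  cvgn u.
Proof.
move=> H; apply/cauchy_cvgP/cauchy_exP => e e0.
have [j _ /(_ j (leqnn j)) je] := near_infty_natSinv_lt (PosNum e0).
have [N HN] := H j; exists (u N).
exists N => // n /= Nn; rewrite /ball/= distrC.
exact: lt_trans (HN _ Nn) je.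
Qed.

Lemma cvgn_of_eq_increments (R : realType) (u v : nat -> R) N :
  (forall n, (N <= n)%N -> u n.+1 - u n = v n.+1 - v n) -> cvgn v -> cvgn u.
Proof.
move=> H cv; have E n : (N <= n)%N -> u n = v n + (u N - v N).
  elim: n => [|n IH]; first by rewrite leqn0 => /eqP ->; lra.
  rewrite leq_eqVlt => /orP[/eqP <-|]; first by lra.
  by rewrite ltnS => Nn; have := H _ Nn; have := IH Nn; lra.
have : cvgn (fun n => v n + (u N - v N)) by apply: is_cvgD => //; apply: is_cvg_cst.
move=> /cvg_ex[x xv]; apply/cvg_ex; exists x; apply: cvg_trans xv.
by apply: near_eq_cvg; exists N => // n /= Nn; rewrite -E.
Qed.

Section transform.
Context {d} {T : measurableType d} {R : realType} (P : probability T R).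
Context {A : finType} (a0 : A) (l : nat -> T -> A) (K : seq A -> A -> R) (n0 : nat).
Hypothesis ml : forall n a, measurable (l n @^-1` [set a]).
Hypothesis chain_rule : forall h a, (n0 <= size h)%N ->
  pr P (atom l (rcons h a)) = pr P (atom l h) * K h a.
Notation hist := (hist l).
Notation mean := (mean K).

Definition noise (f : A -> R) h a := f a - mean h f.

(** The martingale transform of the centred letters by the predictable
    coefficients [c], written as a function of the history so that it can enter
    a potential. *)
Definition transform (c : seq A -> R) f h :=
  \sum_(k < size h) c (take k h) * noise f (take k h) (nth a0 h k).

Lemma transform_rcons c f h a :
  transform c f (rcons h a) = transform c f h + c h * noise f h a.
Proof.
rewrite /transform size_rcons big_ord_recr/= -cats1 take_size_cat//.
rewrite nth_cat ltnn subnn; congr (_ + _); apply: eq_bigr => -[k kh] _ /=.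
by rewrite takel_cat ?(ltnW kh)// nth_cat kh.
Qed.

Lemma transform_hist c f n w : transform c f (hist n w) =
  \sum_(k < n) c (hist k w) * noise f (hist k w) (l k w).
Proof.
rewrite /transform size_hist; apply: eq_bigr => -[k kn] _ /=.
by rewrite nth_hist// take_hist// ltnW.
Qed.

Lemma mean_noise f h : (n0 <= size h)%N -> charged P l h -> mean h (noise f h) = 0.
Proof.
move=> nh ch; rewrite /noise meanD (mean_cst ml chain_rule)//.
by rewrite subrr.
Qed.

Lemma mean_noise2 f h : (forall a, `|f a| <= 1) -> (n0 <= size h)%N ->
  charged P l h -> mean h (fun a => noise f h a ^+ 2) <= 1.
Proof.
move=> f1 nh ch; rewrite /noise; set m := mean h f.
apply: (@le_trans _ _ (mean h (fun a => 1 + (- 2 * m) * f a + m ^+ 2))).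
  apply: (le_mean chain_rule) => // a; rewrite sqrrB.
  have : f a ^+ 2 <= 1 by rewrite -real_normK ?num_real// exprn_ile1.
  rewrite -[f a * m *+ 2]mulr_natr; lra.
rewrite !meanD !(mean_cst ml chain_rule)// meanZ -/m.
have := sqr_ge0 m; lra.
Qed.

Section convergence.
Variables (c : seq A -> R) (f : A -> R) (beta r : nat -> R).
Hypothesis f1 : forall a, `|f a| <= 1.
Hypothesis r_ge0 : forall n, (n0 <= n)%N -> 0 <= r n.
Hypothesis beta_ge0 : forall n, (n0 <= n)%N -> 0 <= beta n.
Hypothesis beta_le : forall n, (n0 <= n)%N -> beta n <= r n - r n.+1.
Hypothesis r_cvg0 : r n @[n --> \oo] --> (0 : R).

(** Truncating a predictable coefficient keeps it predictable and makes the
    variance bound [B * beta] deterministic; on a path where the bound holds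
    eventually, the truncation is eventually inactive. *)
Definition cutoff (B : R) h :=
  if (n0 <= size h)%N && (c h ^+ 2 <= B * beta (size h)) then c h else 0.

Lemma cutoff_le B h : 0 <= B -> (n0 <= size h)%N ->
  cutoff B h ^+ 2 <= B * (r (size h) - r (size h).+1).
Proof.
move=> B0 nh; rewrite /cutoff nh /=.
apply: (@le_trans _ _ (B * beta (size h))); last by rewrite ler_wpM2l// beta_le.
by case: ifP => // _; rewrite expr0n/= mulr_ge0// beta_ge0.
Qed.

(** The increase of the mean square since time [N] is paid for by the decrease
    of the remaining variance [B * r]. The absolute value makes the potential
    non-negative on short histories too. *)
Lemma supermartingale_transform B N : 0 <= B -> (n0 <= N)%N ->
  supermartingale P l K N (fun h => (transform (cutoff B) f h -
    transform (cutoff B) f (take N h)) ^+ 2 + B * `|r (size h)|).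
Proof.
move=> B0 nN h Nh ch; have nh := leq_trans nN Nh.
set u := cutoff B; set m := transform u f h - transform u f (take N h).
rewrite [leLHS](_ : _ = mean h (fun a => m ^+ 2 + B * r (size h).+1 +
   2 * m * u h * noise f h a + u h ^+ 2 * noise f h a ^+ 2)); last first.
  rewrite /mean; apply: eq_bigr => a _; congr (_ * _).
  rewrite size_rcons ger0_norm ?r_ge0//; last exact: leqW.
  by rewrite transform_rcons -cats1 takel_cat// /m; ring.
rewrite meanD meanD meanZ meanZ mean_noise// mulr0 addr0.
rewrite (mean_cst ml chain_rule)// ger0_norm ?r_ge0//.
have := cutoff_le B0 nh; rewrite -/u.
have := mean_noise2 f1 nh ch; set v := mean _ _ => v1 ur.
have : u h ^+ 2 * v <= u h ^+ 2 by rewrite ler_piMr// sqr_ge0.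
by lra.
Qed.

(** Ville's inequality for the potential of [supermartingale_transform], which
    equals [B * r N] at time [N], bounds the probability of an oscillation
    larger than [t] after time [N] by [B * r N / t ^ 2]. This gives the Cauchy
    property. *)
Lemma cutoff_transform_cvg B : 0 <= B ->
  {ae P, forall w, cvgn (fun n => transform (cutoff B) f (hist n w))}.
Proof.
move=> B0; set u := cutoff B.
suff : {ae P, forall w, forall j : nat, exists N, forall n, (N <= n)%N ->
    `|transform u f (hist n w) - transform u f (hist N w)| < j.+1%:R^-1}.
  by apply: filterS => w; exact: cvgn_of_cauchy.
apply/ae_foralln => j; apply: ae_of_small => e e0.
pose t : R := j.+1%:R^-1.
have t0 : 0 < t by rewrite invr_gt0.
have [N nN rN] : exists2 N, (n0 <= N)%N & B * r N <= e * t ^+ 2.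
  have c0 : 0 < e * t ^+ 2 / (B + 1) by rewrite !mulr_gt0// invr_gt0 ltr_wpDl.
  have [N _ HN] := (cvgrPdist_lt _ _).1 r_cvg0 _ c0.
  exists (maxn N n0); first exact: leq_maxr.
  have /= := HN _ (leq_maxl N n0); rewrite sub0r normrN.
  rewrite ger0_norm ?r_ge0 ?leq_maxr// ltr_pdivlMr ?ltr_wpDl// => /ltW.
  apply: le_trans; rewrite mulrC ler_wpM2l ?r_ge0 ?leq_maxr//; lra.
exists (\bigcup_m crossing l N m (fun h =>
    (transform u f h - transform u f (take N h)) ^+ 2 + B * `|r (size h)|) (t ^+ 2)).
  by apply: bigcup_measurable => m _; exact: measurable_crossing.
split=> [|w nQ].
  apply: le_trans (ville ml chain_rule (C := B * r N) nN _ _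
      (supermartingale_transform B0 nN) _) _.
  - by rewrite exprn_gt0.
  - by move=> g; rewrite addr_ge0 ?sqr_ge0// mulr_ge0.
  - move=> h hN; rewrite take_oversize ?hN// subrr expr0n/= add0r.
    by rewrite ger0_norm// r_ge0.
  - by rewrite ler_pdivrMr// exprn_gt0.
apply: contrapT => nc; apply: nQ; exists N => n Nn; rewrite ltNge; apply/negP => H.
apply: nc; exists (n - N)%N => //; exists (n - N)%N => //.
rewrite subnKC// take_hist// -[leLHS]addr0 lerD ?mulr_ge0//.
by rewrite -[leRHS]real_normK ?num_real// lerXn2r ?nnegrE// ltW.
Qed.

(** The summability of [beta] is given by its telescoping majorant [r]. The
    constant [B] may depend on the path, which is why the truncation is used
    for every integer bound at once. *)
Lemma transform_cvg : {ae P, forall w, (exists B, \forall n \near \oo,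
    c (hist n w) ^+ 2 <= B * beta n) ->
  cvgn (fun n => \sum_(k < n) c (hist k w) * noise f (hist k w) (l k w))}.
Proof.
have : {ae P, forall w, forall B : nat,
    cvgn (fun n => transform (cutoff B%:R) f (hist n w))}.
  by apply/ae_foralln => B; exact: cutoff_transform_cvg.
apply: filterS => w cw [B [N _ HN]].
have [b Bb] : exists b : nat, B <= b%:R.
  exists (Num.truncn `|B|).+1; apply: le_trans (ler_norm _) _.
  by rewrite ltW// truncnS_gt.
apply: (cvgn_of_eq_increments (N := maxn N n0)) (cw b) => n; rewrite geq_max.
case/andP=> Nn nn; rewrite !transform_hist !big_ord_recr/=.
rewrite [_ + _ - _]addrAC subrr add0r [RHS]addrAC subrr add0r.
rewrite /cutoff size_hist nn /= ifT//; apply: le_trans (HN n Nn) _.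
by rewrite ler_wpM2r ?beta_ge0.
Qed.

End convergence.

End transform.

(** * Logarithms and sums of relative increments *)

Section increments.
Context {R : realType}.
Implicit Types (x y z e g u v : nat -> R).

(** From [ln u <= u - 1] at [u = (1 + t)^-1]. *)
Lemma ln1D_lb (t : R) : -2^-1 <= t -> t - 2 * t ^+ 2 <= ln (1 + t).
Proof.
move=> t2; have t1 : 0 < 1 + t by lra.
rewrite -[X in ln X]invrK lnV ?posrE ?invr_gt0// lerNr.
have -> : (1 + t)^-1 = 1 + - (t / (1 + t)) by field; lra.
apply: (le_trans (le_ln1Dx _)).
  by rewrite ltrNr opprK ltr_pdivrMr//; lra.
rewrite lerN2 ler_pdivlMr//.
suff : 0 <= t ^+ 2 * (1 + 2 * t) by lra.
by rewrite mulr_ge0 ?sqr_ge0//; lra.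
Qed.

Lemma invn_cvg0 : (n%:R^-1 : R) @[n --> \oo] --> (0 : R).
Proof.
rewrite -(cvg_shiftS (fun n => n%:R^-1 : R)).
exact: cvg_harmonic.
Qed.

Lemma eventually_small (C eta : R) : 0 < eta ->
  exists N, forall n, (N <= n)%N -> C / n%:R <= eta.
Proof.
move=> eta0.
have : (C * n%:R^-1) @[n --> \oo] --> C * 0 by apply: cvgM; [exact: cvg_cst|exact: invn_cvg0].
rewrite mulr0 => /cvgrPdist_lt /(_ _ eta0)[N _ HN].
exists N => n Nn; have /= := HN n Nn; rewrite sub0r normrN.
by move=> /ltW; apply: le_trans; exact: ler_norm.
Qed.

Lemma le_sum_increments y v n0 n : (n0 <= n)%N ->
  (forall k, (n0 <= k < n)%N -> v k.+1 - v k <= y k.+1 - y k) ->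
  v n - v n0 <= y n - y n0.
Proof.
elim: n => [|n IH]; first by rewrite leqn0 => /eqP -> _; lra.
rewrite leq_eqVlt => /orP[/eqP <- _|]; first by lra.
rewrite ltnS => nn H.
have := H n; rewrite nn ltnSn => /(_ isT).
have : v n - v n0 <= y n - y n0.
  by apply: IH => // k /andP[k0 kn]; apply: H; rewrite k0 leqW.
lra.
Qed.

(** The term of index 0 vanishes since [0^-1 = 0], so this is the usual harmonic
    sum over the indices [0 < k < n]. *)
Definition harm n : R := \sum_(k < n) k%:R^-1.

Lemma harmS n : harm n.+1 = harm n + n%:R^-1.
Proof. by rewrite /harm big_ord_recr. Qed.

Lemma sqr_inv_le n : (0 < n)%N -> (n%:R^-1 : R) ^+ 2 <= 2 / n%:R - 2 / n.+1%:R.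
Proof.
move=> n0; have n1 : 1 <= n%:R :> R by rewrite ler1n.
rewrite -[n.+1]addn1 natrD.
have -> : 2 / n%:R - 2 / (n%:R + 1) = 2 / (n%:R * (n%:R + 1)) :> R by field; lra.
rewrite expr2 -invfM ler_pdivlMr ?mulr_gt0//; try lra.
by rewrite ler_pdivrMl ?mulr_gt0//; nra.
Qed.

Section log.
Variables (x d beta r : nat -> R) (B : R) (N : nat).
Hypothesis B0 : 0 <= B.
Hypothesis beta_le : forall n, (N <= n)%N -> beta n <= r n - r n.+1.
Hypothesis r_cvg0 : r n @[n --> \oo] --> (0 : R).
Hypothesis x0 : forall n, (N <= n)%N -> x n != 0.
Hypothesis xS : forall n, (N <= n)%N -> x n.+1 = x n + d n.
Hypothesis d_le : forall n, (N <= n)%N -> (d n / x n) ^+ 2 <= B * beta n.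

(** With [t = d / x], the increment of the sequence is [ln (1 + t) - t], which
    lies between [- 2 * t ^ 2] and 0 once [t] is small: the sequence is
    eventually non-increasing, and bounded below because the squares are
    summable. *)
Lemma ln_sum_cvg : cvgn (fun n => ln `|x n| - \sum_(k < n) d k / x k).
Proof.
pose t n := d n / x n; pose v n := ln `|x n| - \sum_(k < n) t k.
have tr n : (N <= n)%N -> t n ^+ 2 <= B * (r n - r n.+1).
  by move=> Nn; apply: le_trans (d_le Nn) _; rewrite ler_wpM2l// beta_le.
have [M NM tM] : exists2 M, (N <= M)%N & forall n, (M <= n)%N -> `|t n| <= 2^-1.
  have B1 : 0 < 8 * (B + 1) by rewrite mulr_gt0 ?ltr_wpDl.
  have c0 : 0 < (8 * (B + 1))^-1 by rewrite invr_gt0.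
  have [M _ HM] := (cvgrPdist_lt _ _).1 r_cvg0 _ c0.
  exists (maxn M N) => [|n]; rewrite ?leq_maxr// geq_max => /andP[Mn Nn].
  have := HM _ Mn; have := HM _ (leqW Mn); rewrite /= !sub0r !normrN => h1 h2.
  have : r n - r n.+1 <= (4 * (B + 1))^-1.
    have := ler_norm (r n); have := ler_norm (- r n.+1); rewrite normrN.
    have -> : (4 * (B + 1))^-1 = (8 * (B + 1))^-1 + (8 * (B + 1))^-1 :> R.
      by field; lra.
    by lra.
  move=> h; have : t n ^+ 2 <= 4^-1.
    apply: le_trans (tr _ Nn) _; apply: le_trans (ler_wpM2l B0 h) _.
    by rewrite ler_pdivrMr; lra.
  move=> h3; rewrite -ler_sqr ?nnegrE ?normr_ge0//.
  by rewrite real_normK ?num_real//; lra.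
have vS n : (M <= n)%N -> v n.+1 - v n = ln (1 + t n) - t n /\ -2^-1 <= t n.
  move=> Mn; have Nn := leq_trans NM Mn.
  have := tM _ Mn; rewrite ler_norml => /andP[t1 t2]; split=> //.
  have -> : v n.+1 - v n = ln `|x n.+1| - ln `|x n| - t n.
    by rewrite /v big_ord_recr/=; lra.
  have -> : x n.+1 = x n * (1 + t n).
    by rewrite xS// /t mulrDr mulr1 mulrCA divff ?mulr1// x0.
  rewrite normrM lnM ?posrE ?normr_gt0 ?x0//; last by rewrite gt_eqF//; lra.
  by rewrite (ger0_norm (_ : 0 <= 1 + t n))//; lra.
have cv1 : cvgn (fun n => v (n + M)%N).
  have ni : nonincreasing_seq (fun n => v (n + M)%N).
    apply/nonincreasing_seqP => n; have [e1 e2] := vS (n + M)%N (leq_addl _ _).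
    have : ln (1 + t (n + M)%N) <= t (n + M)%N by apply: le_ln1Dx; lra.
    by rewrite addSn; lra.
  apply: nonincreasing_is_cvgn => //.
  have [K [_ HK]] := cvg_seq_bounded (cvgP _ r_cvg0).
  have {HK}rK n : `|r n| <= K + 1 by apply: HK => //; lra.
  exists (v M - 2 * B * (2 * (K + 1))) => _ [n _ <-].
  have : (- (2 * B)) * (- r (n + M)%N) - (- (2 * B)) * (- r M) <= v (n + M)%N - v M.
    apply: (@le_sum_increments v (fun n => - (2 * B) * (- r n))).
      exact: leq_addl.
    move=> k /andP[Mk _]; have [-> e2] := vS _ Mk.
    have := ln1D_lb e2; have := tr _ (leq_trans NM Mk).
    lra.
  have : - (2 * (K + 1)) <= r (n + M)%N - r M.
    by have := rK (n + M)%N; have := rK M; rewrite !ler_norml => /andP[? ?] /andP[? ?]; lra.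
  move=> /(ler_wpM2l (mulr_ge0 (ler0n _ 2) B0)); lra.
move: cv1 => /cvg_ex[s vs]; apply/cvg_ex; exists s.
by rewrite -(cvg_shiftn M).
Qed.

End log.
End increments.

(** * Recursions perturbed by convergent noise *)

Section recursions.
Context {R : realType}.
Implicit Types (x y z e g u v : nat -> R).

Lemma ln_le_harm n : (0 < n)%N -> ln n%:R <= harm n :> R.
Proof.
move=> n0; have := @le_sum_increments R harm (fun n => ln n%:R) 1 n n0.
rewrite ln1 subr0 /harm big_ord1 invr0 subr0; apply=> k /andP[k0 _].
have k1 : 0 < k%:R :> R by rewrite ltr0n.
rewrite -/(harm k.+1) -/(harm k) harmS addrAC subrr add0r.
rewrite -ln_div ?posrE ?ltr0n//.
rewrite (_ : k.+1%:R / k%:R = 1 + k%:R^-1); last first.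
  by rewrite -addn1 natrD mulrDl divff ?mul1r// gt_eqF.
by apply: le_ln1Dx; apply: lt_le_trans (_ : 0 <= _); rewrite ?invr_ge0 ?ltrN10.
Qed.

Lemma ln_unbounded (M : R) : exists N, forall n, (N <= n)%N -> M <= ln n%:R.
Proof.
exists (Num.truncn (expR M)).+1 => n Nn.
have Mn : expR M <= n%:R.
  by apply: le_trans (_ : (Num.truncn (expR M)).+1%:R <= _);
    [exact/ltW/truncnS_gt|rewrite ler_nat].
by rewrite -[M]expRK ler_ln ?posrE ?expR_gt0// (lt_le_trans (expR_gt0 M)).
Qed.

Lemma harm_unbounded (M : R) : exists N, forall n, (N <= n)%N -> M <= harm n.
Proof.
have [N HN] := ln_unbounded M; exists N.+1 => n Nn.
apply: le_trans (HN _ (ltnW Nn)) _.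
by apply: ln_le_harm; apply: leq_trans Nn.
Qed.

(** Below the level [c] the sequence gains at least a fixed multiple of the
    divergent harmonic series, so it comes back above [c]; once above, it can
    only fall through one step, whose size is below [eta] for large times, and
    below [c] it increases. *)
Lemma barrier y (c eta delta C : R) N0 : 0 < delta -> 0 < eta ->
  (forall n, (N0 <= n)%N -> y n <= c -> delta / n.+1%:R <= y n.+1 - y n) ->
  (forall n, (N0 <= n)%N -> - (C / n.+1%:R) <= y n.+1 - y n) ->
  exists N, forall n, (N <= n)%N -> c - eta <= y n.
Proof.
move=> d0 eta0 up low.
have [N1 HN1] := eventually_small C eta0.
pose M := maxn N0 N1.
have [n1 Mn1 yn1] : exists2 n1, (M <= n1)%N & c < y n1.
  apply: contrapT => H.
  have {}H n : (M <= n)%N -> y n <= c.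
    by move=> Mn; rewrite leNgt; apply/negP => cn; apply: H; exists n.
  have [N2 HN2] := harm_unbounded (harm M.+1 + (c - y M + 1) / delta).
  have MN : (M <= maxn M N2)%N by exact: leq_maxl.
  have := @le_sum_increments R y (fun n => delta * harm n.+1) M (maxn M N2) MN.
  have := H _ MN; have := HN2 (maxn M N2).+1 (leqW (leq_maxr _ _)).
  rewrite -lerBrDl ler_pdivrMr// mulrC => h1 h2 h3.
  have : delta * harm (maxn M N2).+1 - delta * harm M.+1 <= y (maxn M N2) - y M.
    apply: h3 => k /andP[Mk _]; rewrite harmS mulrDr addrAC subrr add0r.
    by apply: up; [exact: leq_trans (leq_maxl _ _) Mk|exact: H].
  move=> h4; suff : (1 : R) <= 0 by rewrite ler10.
  by rewrite mulrBr in h1; lra.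
exists n1 => n; elim: n => [|n IH].
  by rewrite leqn0 => /eqP <-; lra.
rewrite leq_eqVlt => /orP[/eqP <-|]; first by lra.
rewrite ltnS => n1n; have Mn := leq_trans Mn1 n1n.
have N0n : (N0 <= n)%N := leq_trans (leq_maxl _ _) Mn.
have N1n : (N1 <= n.+1)%N := leqW (leq_trans (leq_maxr _ _) Mn).
have [yc|yc] := leP (y n) c.
  have u0 : 0 <= delta / n.+1%:R by rewrite divr_ge0// ltW.
  by have := le_trans u0 (up _ N0n yc); have := IH n1n; lra.
have := low _ N0n; have := HN1 _ N1n; set u := C / _ => ? ?; lra.
Qed.

Section perturbed.
Variables (x e g : nat -> R) (C : R) (N0 : nat).
Hypothesis ce : cvgn e.
Hypothesis xS : forall n, (N0 <= n)%N ->
  x n.+1 = x n + g n / n.+1%:R + (e n.+1 - e n).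
Hypothesis gC : forall n, (N0 <= n)%N -> `|g n| <= C.

(** Adding the tail of the noise to [x] removes the noise from the recursion at
    an arbitrarily small cost. *)
Lemma perturbed_shift (eta : R) : 0 < eta -> exists y N1, (N0 <= N1)%N /\
  forall n, (N1 <= n)%N -> [/\ `|x n - y n| <= eta,
    y n.+1 - y n = g n / n.+1%:R & - (C / n.+1%:R) <= y n.+1 - y n].
Proof.
move=> eta0; have [N1 _ HN1] := (cvgrPdist_lt _ _).1 ce _ eta0.
exists (fun n => x n + (limn e - e n)), (maxn N0 N1); split; first exact: leq_maxl.
move=> n; rewrite geq_max => /andP[N0n N1n].
have e1 : x n.+1 + (limn e - e n.+1) - (x n + (limn e - e n)) = g n / n.+1%:R.
  by rewrite xS//; set u := g n / _; lra.
split=> //.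
  rewrite opprD addrA subrr add0r normrN; exact/ltW/HN1.
rewrite e1 -mulNr ler_wpM2r ?invr_ge0//.
by have := gC N0n; rewrite ler_norml => /andP[].
Qed.

Lemma barrier_perturbed (c eta delta : R) : 0 < delta -> 0 < eta ->
  (forall n, (N0 <= n)%N -> x n <= c -> delta <= g n) ->
  exists N, forall n, (N <= n)%N -> c - eta <= x n.
Proof.
move=> d0 eta0 H; have e3 : 0 < eta / 3 by rewrite divr_gt0.
have [y [N1 [N01 HN1]]] := perturbed_shift e3.
have [||N HN] := @barrier y (c - eta / 3) (eta / 3) delta C N1 d0 e3.
- move=> n N1n yc; have [+ -> _] := HN1 _ N1n; rewrite ler_norml => /andP[? ?].
  by rewrite ler_wpM2r ?invr_ge0// H ?(leq_trans N01)//; lra.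
- by move=> n N1n; have [] := HN1 _ N1n.
exists (maxn N N1) => n; rewrite geq_max => /andP[Nn N1n].
by have [+ _ _] := HN1 _ N1n; rewrite ler_norml => /andP[? ?]; have := HN _ Nn; lra.
Qed.

(** The equilibrium 0 of [u - 3 / 2 * u ^ 2] is repelling. Started at a value
    [l], taken to be at most [1 / 3], when both the remaining noise and the steps
    are below [l / 8], the sequence stays above [l / 2], because the drift is
    non-negative between 0 and [2 / 3]. *)
Lemma logistic_bounded_below (l : R) : 0 < l ->
  (forall n, (N0 <= n)%N -> 0 <= x n -> x n - 3 / 2 * x n ^+ 2 <= g n) ->
  (forall N, exists2 n, (N <= n)%N & l <= x n) ->
  exists2 l', 0 < l' & exists N, forall n, (N <= n)%N -> l' <= x n.
Proof.
wlog l13 : l / l <= 3^-1 => [wl l0 H io|l0 H io].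
  have [?|?] := leP l 3^-1; first by apply: wl io.
  by apply: (wl 3^-1) => // N; have [n Nn ?] := io N; exists n => //; lra.
have l8 : 0 < l / 8 by rewrite divr_gt0.
have [y [N1 [N01 HN1]]] := perturbed_shift l8.
have [N2 HN2] := eventually_small C l8.
have [n1] := io (maxn N1 N2); rewrite geq_max => /andP[N1n1 N2n1] ln1.
suff yl n : (n1 <= n)%N -> 5 * l / 8 <= y n.
  exists (l / 2); [lra|exists n1 => n n1n]; have := yl _ n1n.
  by have [+ _ _] := HN1 n (leq_trans N1n1 n1n); rewrite ler_norml => /andP[]; lra.
elim: n => [|n IH].
  rewrite leqn0 => /eqP n10; subst n1.
  by have [+ _ _] := HN1 _ N1n1; rewrite ler_norml => /andP[]; lra.
rewrite leq_eqVlt => /orP[/eqP <-|].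
  by have [+ _ _] := HN1 _ N1n1; rewrite ler_norml => /andP[]; lra.
rewrite ltnS => n1n; have N1n := leq_trans N1n1 n1n.
have := IH n1n => yn; have [] := HN1 _ N1n; rewrite ler_norml => /andP[h1 h2] h3 h4.
have [yl|yl] := leP (y n) (6 * l / 8).
  have gx : 0 <= g n.
    apply: le_trans (H n (leq_trans N01 N1n) _); last by lra.
    rewrite (_ : _ - _ = x n * (1 - 3 / 2 * x n)); last by ring.
    by rewrite mulr_ge0//; lra.
  have : 0 <= g n / n.+1%:R by rewrite divr_ge0.
  by rewrite -h3; lra.
by move: h4 (HN2 n.+1 (leqW (leq_trans N2n1 n1n))); set u := C / _; lra.
Qed.

End perturbed.

(** The last hypothesis excludes convergence to the repelling equilibrium 0;
    away from 0 the drift is bounded below on any interval ending before the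
    attracting equilibrium [2 / 3]. *)
Lemma logistic_liminf z e g (C : R) N0 : cvgn e ->
  (forall n, (N0 <= n)%N -> z n.+1 = z n + g n / n.+1%:R + (e n.+1 - e n)) ->
  (forall n, (N0 <= n)%N -> `|g n| <= C) ->
  (forall n, (N0 <= n)%N -> 0 <= z n -> z n - 3 / 2 * z n ^+ 2 <= g n) ->
  (exists2 l, 0 < l & forall N, exists2 n, (N <= n)%N & l <= z n) ->
  forall eta, 0 < eta -> exists N, forall n, (N <= n)%N -> 2 / 3 - eta <= z n.
Proof.
move=> ce zS gC H [l l0 io] eta eta0.
have [l' l'0 [N HN]] := logistic_bounded_below ce zS gC l0 H io.
have e2 : 0 < eta / 2 by rewrite divr_gt0.
have [||||N' HN'] := @barrier_perturbed z e g C (maxn N0 N) ce _ _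
  (2 / 3 - eta / 2) (eta / 2) (l' * (3 / 4 * eta)) _ e2.
- by move=> n; rewrite geq_max => /andP[? ?]; apply: zS.
- by move=> n; rewrite geq_max => /andP[? ?]; apply: gC.
- by rewrite !mulr_gt0//; lra.
- move=> n; rewrite geq_max => /andP[N0n Nn] zn; have lz := HN _ Nn.
  apply: le_trans (H _ N0n _); last by lra.
  rewrite (_ : _ - _ = z n * (1 - 3 / 2 * z n)); last by ring.
  by apply: ler_pM => //; lra.
by exists N' => n /HN'; lra.
Qed.

Lemma logistic_limsup z e g h (C : R) N0 : cvgn e ->
  (forall n, (N0 <= n)%N -> z n.+1 = z n + g n / n.+1%:R + (e n.+1 - e n)) ->
  (forall n, (N0 <= n)%N -> `|g n| <= C) ->
  (forall n, (N0 <= n)%N -> g n <= z n - 3 / 2 * z n ^+ 2 + h n) ->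
  h n @[n --> \oo] --> (0 : R) ->
  forall eta, 0 < eta -> exists N, forall n, (N <= n)%N -> z n <= 2 / 3 + eta.
Proof.
move=> ce zS gC H h0 eta eta0.
have e4 : 0 < eta / 4 by rewrite divr_gt0.
have e2 : 0 < eta / 2 by rewrite divr_gt0.
have [N _ HN] := (cvgrPdist_lt _ _).1 h0 _ e4.
have [|||N' HN'] := @barrier_perturbed (fun n => - z n) (fun n => - e n)
  (fun n => - g n) C (maxn N0 N) (is_cvgN ce) _ _
  (- (2 / 3 + eta / 2)) (eta / 2) (eta / 4) e4 e2.
- by move=> n; rewrite geq_max => /andP[? ?]; rewrite zS// mulNr; set u := g n / _; lra.
- by move=> n; rewrite geq_max => /andP[? ?]; rewrite normrN; apply: gC.
- move=> n; rewrite geq_max => /andP[N0n Nn] zn.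
  have := HN n Nn; rewrite /= sub0r normrN ltr_norml => /andP[_ hn].
  have := H _ N0n.
  have : 2 / 3 * (3 / 4 * eta) <= z n * (3 / 2 * z n - 1) by apply: ler_pM => //; lra.
  by lra.
by exists N' => n /HN'; lra.
Qed.

(** The barrier lemma applies to both [s] and [- s], with a level on either side
    of 0. *)
Lemma contraction_cvg0 s e a (C delta : R) N0 : cvgn e -> 0 < delta ->
  (forall n, (N0 <= n)%N -> s n.+1 = s n + (a n * s n) / n.+1%:R + (e n.+1 - e n)) ->
  (forall n, (N0 <= n)%N -> `|a n * s n| <= C) ->
  (forall n, (N0 <= n)%N -> a n <= - delta) ->
  s n @[n --> \oo] --> (0 : R).
Proof.
move=> ce d0 sS aC ad; apply/cvgrPdist_le => eta eta0.
have e2 : 0 < eta / 2 by rewrite divr_gt0.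
have de2 : 0 < delta * (eta / 2) by rewrite mulr_gt0.
have [|N1 HN1] := @barrier_perturbed s e (fun n => a n * s n) C N0 ce sS aC
  (- (eta / 2)) (eta / 2) _ de2 e2.
  move=> n N0n sn; rewrite -[leRHS]mulrNN; apply: ler_pM => //; have := ad _ N0n; lra.
have [|||N2 HN2] := @barrier_perturbed (fun n => - s n) (fun n => - e n)
  (fun n => - (a n * s n)) C N0 (is_cvgN ce) _ _ (- (eta / 2)) (eta / 2) _ de2 e2.
- by move=> n N0n; rewrite sS// mulNr; set u := _ / n.+1%:R; lra.
- by move=> n N0n; rewrite normrN aC.
- move=> n N0n sn; rewrite -mulNr; apply: ler_pM => //; have := ad _ N0n; lra.
exists (maxn N1 N2) => // n /=; rewrite geq_max => /andP[/HN1 h1 /HN2 h2].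
by rewrite sub0r normrN ler_norml; apply/andP; split; lra.
Qed.

End recursions.

(** * Independence of an event from a set of sources *)

Section independence.
Context {d} {T : measurableType d} {R : realType} (P : probability T R).
Context {I : choiceType} (F : I -> set (set T)).
Hypothesis F_measurable : forall i B, F i B -> measurable B.
Hypothesis F_indep : mutually_independent P F.

(** Independence of [E] from the joint draws of the sources selected by [Q],
    together with measurability; this is the induction invariant that replaces
    generated filtrations. *)
Definition indep_of (Q : pred I) (E : set T) := measurable E /\
  forall (J : {fset I}) (A : I -> set T), (forall i, i \in J -> Q i) ->
    (forall i, i \in J -> F i (A i)) ->
    pr P (E `&` \bigcap_(i in [set` J]) A i) = pr P E * \prod_(i <- J) pr P (A i).

Lemma indep_setT : indep_of predT setT.
Proof. by split=> // J A _ FA; rewrite setTI pr_setT mul1r; exact: F_indep. Qed.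

Lemma indep_sub (Q Q' : pred I) E : (forall i, Q' i -> Q i) -> indep_of Q E -> indep_of Q' E.
Proof. by move=> QQ [mE H]; split=> // J A QJ; apply: H => i /QJ /QQ. Qed.

Lemma measurable_bigcap_fset (J : {fset I}) (A : I -> set T) :
  (forall i, i \in J -> F i (A i)) -> measurable (\bigcap_(i in [set` J]) A i).
Proof.
move=> FA; apply: fin_bigcap_measurable => [|i iJ]; first exact: finite_fset.
exact: F_measurable (FA _ iJ).
Qed.

(** Intersecting with an event of the source [i0] uses that source up: in the
    product formula for the other sources, [i0] is added to the index set. *)
Lemma indep_step (Q : pred I) E i0 B : indep_of Q E -> Q i0 -> F i0 B ->
  indep_of (fun i => Q i && (i != i0)) (E `&` B) /\
  pr P (E `&` B) = pr P E * pr P B.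
Proof.
move=> [mE H] Qi0 FB; have mB := F_measurable FB.
have EB : pr P (E `&` B) = pr P E * pr P B.
  have := H [fset i0]%fset (fun=> B).
  rewrite big_seq_fset1 set_fset1 bigcap_set1; apply=> i; rewrite inE => /eqP -> //.
split=> //; split=> [|J A QJ FA]; first exact: measurableI.
have i0J : i0 \notin J by apply/negP => /QJ; rewrite eqxx andbF.
pose A' i := if i == i0 then B else A i.
have A'E i : i \in J -> A' i = A i.
  by rewrite /A'; case: eqP => // ->; rewrite (negbTE i0J).
have A'0 : A' i0 = B by rewrite /A' eqxx.
have := H (i0 |` J)%fset A'.
have -> : \bigcap_(i in [set` (i0 |` J)%fset]) A' i = B `&` \bigcap_(i in [set` J]) A i.
  rewrite set_fsetU set_fset1 bigcap_setU bigcap_set1 A'0; congr (_ `&` _).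
  by apply: eq_bigcapr => i iJ; rewrite A'E.
rewrite big_fsetU1//= A'0 setIA => ->.
- rewrite EB -!mulrA; congr (_ * (_ * _)); rewrite !big_seq.
  by apply: eq_bigr => i iJ; rewrite A'E.
- by move=> i; rewrite !inE => /orP[/eqP -> //|/QJ /andP[]].
- move=> i; rewrite !inE => /orP[/eqP ->|iJ]; first by rewrite A'0.
  by rewrite A'E//; apply: FA.
Qed.

End independence.

(** Disjoint events of total probability 1 leave a null remainder, so they
    decompose every probability although they need not cover the space. *)
Lemma pr_exhaust d (T : measurableType d) (R : realType) (P : probability T R)
    (I : finType) (G : I -> set T) E :
  (forall i, measurable (G i)) -> (forall i j w, G i w -> G j w -> i = j) ->
  \sum_i pr P (G i) = 1 -> measurable E -> pr P E = \sum_i pr P (E `&` G i).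
Proof.
move=> mG Gd G1 mE.
pose Y w := [pick i | `[< G i w >]].
have YS i : Y @^-1` [set Some i] = G i.
  apply/seteqP; split=> w; rewrite /Y /=; case: pickP => [j /asboolP Gj|H] //.
  - by case=> <-.
  - by move=> Gi; rewrite (Gd _ _ _ Gj Gi).
  - by move=> Gi; have := H i; rewrite asboolT.
have mY o : measurable (Y @^-1` [set o]).
  case: o => [i|]; first by rewrite YS.
  rewrite (_ : _ @^-1` _ = ~` (\bigcup_(i in [set: I]) G i)).
    by apply/measurableC; apply: fin_bigcup_measurable.
  apply/seteqP; split=> w; rewrite /Y /=; case: pickP => [j /asboolP Gj|H] //.
  - by move=> _ [i _ Gi]; have := H i; rewrite asboolT.
  - by move=> nG; exfalso; apply: nG; exists j.
have sumo (f : option I -> R) : \sum_o f o = f None + \sum_i f (Some i).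
  rewrite (bigD1 None)//=; congr (_ + _).
  rewrite (reindex_omap Some id)/=; last by case.
  by apply: eq_bigl => i; rewrite eqxx.
have := pr_partition P mY measurableT; rewrite pr_setT sumo setTI.
under eq_bigr do rewrite setTI YS.
rewrite G1 => N0.
rewrite (pr_partition P mY mE) sumo.
under eq_bigr do rewrite YS.
rewrite [X in X + _](_ : _ = 0) ?add0r//.
apply/eqP; rewrite eq_le pr_ge0 andbT.
apply: (@le_trans _ _ (pr P (Y @^-1` [set None]))); last by lra.
by apply: le_pr => //; apply: measurableI.
Qed.

(** * The law of a step given the history *)

(** The random variables are unconstrained real functions on a null set, so a
    step is first rounded to a finite alphabet, [None] coding an idle step. *)
Definition letter {R : realType} (x : R) : option bool :=
  if x == 1 then Some true else if x == -1 then Some false else None.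

Definition sgn {R : realType} (b : bool) : R := if b then 1 else -1.

Definition val_of {R : realType} (a : option bool) : R :=
  if a is Some b then sgn b else 0.

Lemma letterK {R : realType} : cancel val_of (@letter R).
Proof.
rewrite /letter; case=> [[]|] /=; rewrite ?eqxx//.
  by rewrite (lt_eqF (_ : -1 < 1))//; lra.
by rewrite (lt_eqF ltr01) (gt_eqF (ltrN10 R)).
Qed.

Section kernel.
Context {R : realType} (p : R).
Implicit Type h : seq (option bool).

Definition pos h : R := \sum_(a <- h) val_of a.
Definition moves h : R := \sum_(a <- h) `|val_of a|.
Definition pos_freq h : R := pos h / (size h)%:R.
Definition move_freq h : R := moves h / (size h)%:R.

(** The law of one recalled and possibly reversed step: with [z] the frequency of
    non-zero steps and [s] the mean of the past steps, it equals 1 with probability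
    [(z + q s) / 2] and -1 with probability [(z - q s) / 2], for [q = 2 p - 1]. *)
Definition recall_law h (a : option bool) : R :=
  match a with
  | Some true => (move_freq h + (2 * p - 1) * pos_freq h) / 2
  | Some false => (move_freq h - (2 * p - 1) * pos_freq h) / 2
  | None => 1 - move_freq h
  end.

(** The sign of a sum of two independent recalled steps is the sign of one of
    them unless they cancel or both vanish. *)
Definition step_law h (a : option bool) : R :=
  match a with
  | Some b => recall_law h (Some b) ^+ 2 +
              2 * recall_law h (Some b) * recall_law h None
  | None => recall_law h None ^+ 2 +
              2 * recall_law h (Some true) * recall_law h (Some false)
  end.

Definition draw_weight n (c : 'I_n * bool) : R := (if c.2 then p else 1 - p) / n%:R.

Definition draw_value n h (c : 'I_n * bool) : R :=
  sgn c.2 * val_of (nth None h c.1).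

Lemma sum_pair_bool n (f : 'I_n * bool -> R) :
  \sum_c f c = \sum_(i < n) (f (i, true) + f (i, false)).
Proof.
rewrite (eq_bigr (fun c => f (c.1, c.2))); last by case.
rewrite -(pair_bigA _ (fun i b => f (i, b)))/=; apply: eq_bigr => i _.
by rewrite big_bool.
Qed.

Lemma sum_option_bool (f : option bool -> R) :
  \sum_a f a = f (Some true) + f (Some false) + f None.
Proof.
rewrite (bigD1 (Some true))//= (bigD1 (Some false))//= (bigD1 None)//= big1 ?addr0 ?addrA//.
by case=> [[]|].
Qed.

Lemma sum_draw_weight n : (0 < n)%N -> \sum_(c : 'I_n * bool) draw_weight c = 1.
Proof.
move=> n0; rewrite sum_pair_bool /draw_weight /=.
under eq_bigr do rewrite -mulrDl addrC subrK div1r.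
by rewrite sumr_const card_ord -[LHS]mulr_natr mulVf// pnatr_eq0 -lt0n.
Qed.

Lemma posE h : pos h = \sum_(i < size h) val_of (nth None h i).
Proof. by rewrite /pos (big_nth None) big_mkord. Qed.

Lemma movesE h : moves h = \sum_(i < size h) `|val_of (nth None h i)|.
Proof. by rewrite /moves (big_nth None) big_mkord. Qed.

(** For a fixed remembered step [v] in [-1, 0, 1], the mean of [g] over the sign
    draw is affine in [v] and [`|v|], so the mean over the index only depends on
    the two frequencies. *)
Lemma draw_value_law n h (g : R -> R) : (0 < n)%N -> size h = n ->
  \sum_(c : 'I_n * bool) draw_weight c * g (draw_value h c) =
  \sum_a recall_law h a * g (val_of a).
Proof.
move=> h0 hn; subst n; rewrite sum_pair_bool sum_option_bool /=.
have n0 : (size h)%:R != 0 :> R by rewrite pnatr_eq0 -lt0n.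
pose v i : R := val_of (nth None h i).
rewrite (eq_bigr (fun i : 'I_(size h) => (size h)%:R^-1 *
   (`|v i| * ((g 1 + g (-1)) / 2 - g 0) +
    v i * ((2 * p - 1) * (g 1 - g (-1)) / 2) + g 0))); last first.
  move=> i _; rewrite /draw_weight /draw_value /= -/(v i) /v.
  case: (nth None h i) => [[]|] /=;
    rewrite ?mulr1 ?mulr0 ?mulN1r ?mul1r ?opprK ?normrN ?normr1 ?normr0; by field.
rewrite -mulr_sumr !big_split/= -!mulr_suml -movesE -posE sumr_const card_ord.
rewrite -mulr_natr /move_freq /pos_freq.
by field.
Qed.

Definition outcome n h (c : ('I_n * bool) * ('I_n * bool)) : option bool :=
  letter (Num.sg (draw_value h c.1 + draw_value h c.2)).

Lemma step_law_draw n h a : (0 < n)%N -> size h = n ->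
  \sum_(c : ('I_n * bool) * ('I_n * bool) | outcome h c == a)
     draw_weight c.1 * draw_weight c.2 = step_law h a.
Proof.
move=> h0 hn; rewrite /outcome big_mkcond /=.
rewrite (eq_bigr (fun c => draw_weight c.1 * (draw_weight c.2 *
   (letter (Num.sg (draw_value h c.1 + draw_value h c.2)) == a)%:R))); last first.
  by move=> c _; case: ifP => _; rewrite ?mulr1 ?mulr0.
rewrite -(pair_bigA _ (fun c1 c2 => draw_weight c1 * (draw_weight c2 *
   (letter (Num.sg (draw_value h c1 + draw_value h c2)) == a)%:R)))/=.
under eq_bigr => c1 _ do rewrite -mulr_sumr
  (draw_value_law (fun y => (letter (Num.sg (draw_value h c1 + y)) == a)%:R) h0 hn).
rewrite (draw_value_law (fun x => \sum_b recall_law h b *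
    (letter (Num.sg (x + val_of b)) == a)%:R) h0 hn).
rewrite !sum_option_bool /=.
have s2 : Num.sg (1 + 1 : R) = 1 by rewrite gtr0_sg.
have sN2 : Num.sg (-1 - 1 : R) = -1 by rewrite ltr0_sg//; lra.
rewrite !(addrN, addNr, addr0, add0r, s2, sN2, sgr0, sgr1, sgrN).
rewrite (letterK (Some true)) (letterK (Some false)) (letterK None).
by case: a => [[]|] /=; rewrite ?mulr1 ?mulr0; ring.
Qed.

End kernel.

(** * The chain rule of the walk *)

Lemma sgn_inj {R : realType} : injective (@sgn R).
Proof.
move=> b c bc; suff: Some b = Some c by case.
by rewrite -(letterK (R := R) (Some b)) /= bc (letterK (Some c)).
Qed.

Lemma val_of_letter {R : realType} (x : R) :
  letter x != None -> x = val_of (letter x).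
Proof. by rewrite /letter; case: (x =P 1) => // _; case: (x =P -1). Qed.

Section law.
Context {d} {T : measurableType d} {R : realType} (P : probability T R).
Variables (X : nat -> {RV P >-> R}) (U : 'I_2 -> nat -> {RV P >-> nat})
  (sigma : 'I_2 -> nat -> {RV P >-> R}) (p : R).
Hypothesis hX : elephant_walk X U sigma p.

Definition step n w : option bool := letter (X n.+1 w).

Local Notation hist := (hist step).
Local Notation atom := (atom step).
Local Notation F := (source_sigma X U sigma).
Local Notation source := ('I_2 + ('I_2 * nat) + ('I_2 * nat))%type.

Lemma source_measurable s B : F s B -> measurable B.
Proof.
case: s => [[k|[i n]]|[i n]] /= [C mC <-]; rewrite setTI -[X in measurable X]setTI;
  exact: measurable_funP.
Qed.

Lemma step_some n b : step n @^-1` [set Some b] = X n.+1 @^-1` [set sgn b].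
Proof.
apply/seteqP; split=> w /= => [h|h]; last by rewrite /step h (letterK (Some b)).
by rewrite [LHS]val_of_letter -/(step n w) h.
Qed.

Lemma measurable_step n a : measurable (step n @^-1` [set a]).
Proof.
have mp (y : R) : measurable (X n.+1 @^-1` [set y]).
  by rewrite -[X in measurable X]setTI; exact: measurable_funP.
case: a => [b|]; first by rewrite step_some.
rewrite (_ : _ @^-1` _ =
    ~` (step n @^-1` [set Some true] `|` step n @^-1` [set Some false])).
  by apply: measurableC; apply: measurableU; rewrite step_some.
apply/seteqP; split=> w /=; first by move=> ->; case.
by case: (step n w) => [[]|] // []; [left|right].
Qed.
#[local] Hint Resolve measurable_step : core.

(** The first two steps of the walk are almost surely non-zero. On such
    histories letters determine the real steps, and there are at least two
    non-zero steps to remember. *)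
Definition valid (h : seq (option bool)) :=
  [&& (2 <= size h)%N, nth None h 0 != None & nth None h 1 != None].

(** From the third step on, a step is a sign, so no information is lost by the
    rounding; for the first two steps this is what validity provides. *)
Lemma val_step k h w : valid h -> atom h w -> (k < size h)%N ->
  X k.+1 w = val_of (nth None h k).
Proof.
case/and3P => h2 v0 v1 hw kh; have sk : step k w = nth None h k.
  by rewrite -[in RHS]hw nth_hist.
rewrite -sk; have [k2|k2] := ltnP k 2.
  have : step k w != None by rewrite sk; case: k k2 {kh sk} => [|[|]].
  exact: val_of_letter.
have [y Xy] : exists y, X k.+1 w = Num.sg y by eexists; rewrite (step_eq hX w k2).
rewrite /step Xy.
have [y0|y0|->] := ltrgt0P y.
- by rewrite gtr0_sg// (letterK (Some true)).
- by rewrite ltr0_sg// (letterK (Some false)).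
- by rewrite sgr0 (letterK None).
Qed.

(** The sources of index [n] are those drawn at time [n.+3], so they are later
    than the first [n.+2] steps. *)
Definition late n : pred source := fun s =>
  match s with
  | inl (inl _) => false
  | inl (inr (_, k)) => (n <= k)%N
  | inr (_, k) => (n <= k)%N
  end.

Definition draw n (c : ('I_n.+2 * bool) * ('I_n.+2 * bool)) : set T :=
  U 0 n.+3 @^-1` [set (c.1.1 : nat).+1] `&` sigma 0 n.+3 @^-1` [set sgn c.1.2] `&`
  (U 1 n.+3 @^-1` [set (c.2.1 : nat).+1] `&` sigma 1 n.+3 @^-1` [set sgn c.2.2]).

Lemma source_index i n (k : nat) : F (inl (inr (i, n))) (U i n.+3 @^-1` [set k]).
Proof. by exists [set k] => //; rewrite setTI. Qed.

Lemma source_sign i n (x : R) : F (inr (i, n)) (sigma i n.+3 @^-1` [set x]).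
Proof. by exists [set x] => //; rewrite setTI. Qed.

Lemma source_first (k : 'I_2) (x : R) : F (inl (inl k)) (X k.+1 @^-1` [set x]).
Proof. by exists [set x] => //; rewrite setTI. Qed.

Lemma pr_index i n (k : 'I_n.+2) : pr P (U i n.+3 @^-1` [set k.+1]) = n.+2%:R^-1.
Proof. by rewrite /pr (index_law hX)//= ltn_ord. Qed.

Lemma pr_sign i n b : pr P (sigma i n.+3 @^-1` [set sgn b]) = if b then p else 1 - p.
Proof.
have [h1 h2] := sign_law hX i (n := n.+2) isT.
by rewrite /pr /sgn; case: b; rewrite ?h1 ?h2.
Qed.

Lemma indep_draw n E (c : ('I_n.+2 * bool) * ('I_n.+2 * bool)) : indep_of P F (late n) E ->
  indep_of P F (late n.+1) (E `&` draw c) /\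
  pr P (E `&` draw c) = pr P E * (draw_weight p c.1 * draw_weight p c.2).
Proof.
move=> iE.
have [i1 e1] := indep_step source_measurable iE
  (i0 := inl (inr (ord0, n))) (leqnn n) (source_index 0 n c.1.1.+1).
have [|i2 e2] := indep_step source_measurable i1
  (i0 := inr (ord0, n)) _ (source_sign 0 n (sgn c.1.2)); first by rewrite /= leqnn.
have [|i3 e3] := indep_step source_measurable i2
  (i0 := inl (inr (1, n))) _ (source_index 1 n c.2.1.+1).
  by rewrite /= leqnn.
have [|i4 e4] := indep_step source_measurable i3
  (i0 := inr (1, n)) _ (source_sign 1 n (sgn c.2.2)).
  by rewrite /= leqnn.
rewrite /draw !setIA; split.
  apply: indep_sub i4 => -[[k|[i k]]|[i k]] //= nk; rewrite (ltnW nk) /=;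
    do ?[apply/andP; split=> //]; by apply/eqP => -[_ kn]; rewrite kn ltnn in nk.
rewrite e4 e3 e2 e1 !pr_index !pr_sign /draw_weight; ring.
Qed.

Lemma draw_exhaust n E : measurable E -> pr P E = \sum_c pr P (E `&` @draw n c).
Proof.
move=> mE; have D c := @indep_draw n setT c
  (indep_sub (fun _ _ => isT) (indep_setT (sources_independent hX))).
apply: pr_exhaust => //.
- by move=> c; have [[+ _] _] := D c; rewrite setTI.
- move=> [[u1 b1] [u2 b2]] [[v1 c1] [v2 c2]] w [[/= + +] [/= + +]] [[/= + +] [/= + +]].
  move=> -> -> -> -> [/ord_inj ->] e1 [/ord_inj ->] e2.
  by rewrite (sgn_inj e1) (sgn_inj e2).
- under eq_bigr => c _ do rewrite -[@draw n c]setTI (proj2 (D c)) pr_setT mul1r.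
  rewrite -(pair_bigA _ (fun c1 c2 => draw_weight p c1 * draw_weight p c2))/=.
  by under eq_bigr => c1 _ do rewrite -mulr_sumr sum_draw_weight// mulr1;
    rewrite sum_draw_weight.
Qed.

Local Notation outcome := (@outcome R _).

Lemma step_outcome n h c w : valid h -> size h = n.+2 -> atom h w -> @draw n c w ->
  step n.+2 w = outcome h c.
Proof.
move=> vh hn hw [[/= u0 s0] [/= u1 s1]].
rewrite /outcome /draw_value.
rewrite /step (step_eq hX)// !big_ord_recl big_ord0 addr0 /recalled.
rewrite (_ : lift ord0 ord0 = 1); last exact/val_inj.
by rewrite u0 u1 s0 s1 !(val_step vh hw) ?hn ?ltn_ord.
Qed.

Lemma atom_rcons_draw n h a c W : valid h -> size h = n.+2 ->
  atom (rcons h a) `&` W `&` @draw n c =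
  if outcome h c == a then atom h `&` draw c `&` W else set0.
Proof.
move=> vh hn; rewrite atom_rcons hn; apply/seteqP; split=> w.
  move=> [[[hw /= wa] Ww] cw]; move: (step_outcome vh hn hw cw).
  by rewrite wa => ->; rewrite eqxx.
case: eqP => // <- [[hw cw] Ww]; do !split=> //.
exact: step_outcome.
Qed.

Lemma pr_atom_rcons n h a W : valid h -> size h = n.+2 -> measurable W ->
  pr P (atom (rcons h a) `&` W) =
  \sum_(c | outcome h c == a) pr P (atom h `&` @draw n c `&` W).
Proof.
move=> vh hn mW; rewrite (@draw_exhaust n).
  rewrite [RHS]big_mkcond; apply: eq_bigr => c _.
  by rewrite atom_rcons_draw//; case: ifP => // _; rewrite pr_set0.
by apply: measurableI => //; apply: measurable_atom.
Qed.

(** Given the history, the next step is a function of the draw. The atom of the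
    longer history is therefore, up to a null set, a finite disjoint union of
    intersections of the shorter atom with draws, each independent of all later
    sources. *)
Lemma indep_atom_step n h a : valid h -> size h = n.+2 ->
  indep_of P F (late n) (atom h) ->
  indep_of P F (late n.+1) (atom (rcons h a)) /\
  pr P (atom (rcons h a)) = pr P (atom h) * step_law p h a.
Proof.
move=> vh hn ih; have D c := @indep_draw n _ c ih.
have e1 : pr P (atom (rcons h a)) = \sum_(c | outcome h c == a)
    pr P (atom h `&` @draw n c).
  rewrite -[atom (rcons h a)]setIT (pr_atom_rcons _ vh hn)//.
  by apply: eq_bigr => c _; rewrite setIT.
split; last first.
  rewrite e1; under eq_bigr => c _ do rewrite (proj2 (D c)).
  rewrite -mulr_sumr; congr (_ * _).
  by rewrite step_law_draw.
split; first exact: measurable_atom.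
move=> J A lJ FA; rewrite (pr_atom_rcons _ vh hn); last first.
  exact: measurable_bigcap_fset source_measurable _ _ FA.
rewrite e1 mulr_suml; apply: eq_bigr => c _.
by have [[_ H] _] := D c; apply: H.
Qed.

Lemma indep_atom n h : valid h -> size h = n.+2 -> indep_of P F (late n) (atom h).
Proof.
elim: n h => [|n IH] h vh hn.
  have [a [b hab]] : exists a b, h = [:: Some a; Some b].
    move: vh hn; rewrite /valid; case: h => [|[a|] [|[b|] [|? ?]]] // _ _.
    by exists a, b.
  have iT := indep_setT (sources_independent hX).
  have [//|i1 _] := indep_step source_measurable iT
    (i0 := inl (inl ord0)) _ (source_first ord0 (sgn a)).
  have [//|i2 _] := indep_step source_measurable i1
    (i0 := inl (inl 1)) _ (source_first 1 (sgn b)).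
  rewrite hab -[[:: Some a; Some b]]/(rcons (rcons [::] (Some a)) (Some b)).
  rewrite !atom_rcons !step_some.
  rewrite (_ : atom [::] = setT); last by apply/seteqP; split.
  by apply: indep_sub i2 => -[[k|[i k]]|[i k]].
have [h' [a [hE h'n]]] : exists h' a, h = rcons h' a /\ size h' = n.+2.
  case/lastP: h hn {vh} => // h' a; rewrite size_rcons => -[hn].
  by exists h', a.
have vh' : valid h'.
  move: vh; rewrite hE /valid h'n size_rcons h'n !nth_rcons h'n //=.
by have [] := indep_atom_step a vh' h'n (IH _ vh' h'n); rewrite -hE.
Qed.

Lemma pr_first_none (k : 'I_2) : pr P (step k @^-1` [set None]) = 0.
Proof.
have := pr_partition P (measurable_step k) measurableT.
rewrite pr_setT sum_option_bool !setTI !step_some /pr.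
have [-> ->] := first_steps_law hX k; rewrite /=; lra.
Qed.

Lemma charged_valid h : (2 <= size h)%N -> charged P step h -> valid h.
Proof.
move=> h2; apply: contraTT; rewrite /valid h2 /= negb_and /charged !negbK.
have atom0 (k : 'I_2) : nth None h k = None -> pr P (atom h) == 0.
  move=> hk; rewrite eq_le pr_ge0 andbT -(pr_first_none k); apply: le_pr => //.
    exact: measurable_atom.
  by move=> w hw /=; rewrite -hk -hw nth_hist// (leq_trans (ltn_ord k)).
by case/orP => /eqP; [exact: (atom0 0)|exact: (atom0 1)].
Qed.

(** An atom that is not valid is null, and then both sides vanish. *)
Theorem chain_rule h a : (2 <= size h)%N ->
  pr P (atom (rcons h a)) = pr P (atom h) * step_law p h a.
Proof.
move=> h2; have [/(charged_valid h2) vh|nc] := boolP (charged P step h).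
  have hn : size h = (size h).-2.+2 by case: (size h) h2 => [|[]].
  by have [] := indep_atom_step a vh hn (indep_atom vh hn).
rewrite atom_rcons pr_atom_eq0//; move: nc; rewrite /charged negbK => /eqP ->.
by rewrite mul0r.
Qed.

End law.

(** * Drifts and potentials of the walk *)

Section drift.
Context {R : realType} (p : R).
Hypotheses (p0 : 0 < p) (p1 : p < 1).
Implicit Type h : seq (option bool).
Local Notation q := (2 * p - 1).
Local Notation mean := (mean (step_law p)).
Local Notation val := (@val_of R).
Local Notation z := (@move_freq R).
Local Notation s := (@pos_freq R).

(** The exponent of the mean growth: the conditional mean of the next step is
    [bias h * s h], that is [bias h / n] times the current position. *)
Definition bias h : R := q * (2 - z h).
(** The conditional probability that the next step is non-zero, which is also its
    conditional second moment. *)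
Definition activity h : R := 2 * z h - 3 / 2 * z h ^+ 2 + q ^+ 2 * s h ^+ 2 / 2.

Lemma mean_affine h (a b c : R) (f : option bool -> R) :
  (forall x, f x = a + b * val x + c * `|val x|) ->
  mean h f = a + b * (bias h * s h) + c * activity h.
Proof.
move=> fE; rewrite /mean sum_option_bool !fE /= normrN normr0 normr1.
by rewrite /bias /activity; field.
Qed.

Lemma mean_val h : mean h val = bias h * s h.
Proof. by rewrite (@mean_affine h 0 1 0) => [|x]; ring. Qed.

Lemma mean_norm_val h : mean h (fun x => `|val x|) = activity h.
Proof. by rewrite (@mean_affine h 0 0 1) => [|x]; ring. Qed.

Lemma norm_val_le1 x : `|val x| <= 1.
Proof. by case: x => [[]|] /=; rewrite ?normrN ?normr1 ?normr0. Qed.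

Lemma sqr_val x : val x ^+ 2 = `|val x|.
Proof. by case: x => [[]|] /=; rewrite ?normrN ?normr1 ?normr0 ?sqrrN ?expr1n ?expr0n. Qed.

Lemma pos_rcons h x : pos (rcons h x) = pos h + val x.
Proof. by rewrite /pos -cats1 big_cat big_seq1. Qed.

Lemma moves_rcons h x : moves (rcons h x) = moves h + `|val x|.
Proof. by rewrite /moves -cats1 big_cat big_seq1. Qed.

Lemma norm_pos_le h : `|pos h : R| <= moves h.
Proof. exact: ler_norm_sum. Qed.

Lemma moves_le_size h : moves h <= (size h)%:R :> R.
Proof.
elim/last_ind: h => [|h x IH]; first by rewrite /moves big_nil.
by rewrite moves_rcons size_rcons -addn1 natrD lerD// norm_val_le1.
Qed.

Lemma moves_ge0 h : 0 <= moves h :> R.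
Proof. exact: sumr_ge0. Qed.

Lemma moves_ge2 h : valid h -> 2 <= moves h :> R.
Proof.
case: h => [|[a|] [|[b|] h]] //= _; rewrite /moves !big_cons.
have n1 c : `|val (Some c)| = 1 by case: c => /=; rewrite ?normrN normr1.
by rewrite !n1 addrA lerDl; exact: sumr_ge0.
Qed.

Lemma freq_bounds h : 0 <= z h <= 1 /\ `|s h| <= z h.
Proof.
rewrite /move_freq /pos_freq; split.
  rewrite divr_ge0 ?moves_ge0//=.
  have [->|h0] := eqVneq (size h) 0%N; first by rewrite invr0 mulr0.
  by rewrite ler_pdivrMr ?ltr0n ?lt0n// mul1r moves_le_size.
by rewrite normrM (ger0_norm (x := _^-1))// ler_wpM2r// norm_pos_le.
Qed.

Lemma activity_ge h : 2 * z h - 3 / 2 * z h ^+ 2 <= activity h.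
Proof. by rewrite /activity lerDl mulr_ge0// mulr_ge0// sqr_ge0. Qed.

Lemma q2_le1 : q ^+ 2 <= 1.
Proof.
rewrite -real_normK ?num_real// exprn_ile1// ler_norml.
by move: p0 p1 => ? ?; apply/andP; split; lra.
Qed.

Lemma activity_le1 h : activity h <= 1.
Proof.
have [/andP[z0 z1] sz] := freq_bounds h; rewrite /activity.
have s2 : s h ^+ 2 <= z h ^+ 2 by rewrite -[s h ^+ 2]real_normK ?num_real// lerXn2r.
have : q ^+ 2 * s h ^+ 2 <= z h ^+ 2.
  by rewrite -[leRHS]mul1r ler_pM ?sqr_ge0 ?q2_le1.
have : 0 <= (1 - z h) ^+ 2 by rewrite sqr_ge0.
by lra.
Qed.

Lemma recall_law_ge0 h x : 0 <= recall_law p h x.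
Proof.
have [/andP[z0 z1] sz] := freq_bounds h.
have : `|q * s h| <= z h.
  rewrite normrM -[leRHS]mul1r ler_pM// ler_norml.
  by move: p0 p1 => ? ?; apply/andP; split; lra.
rewrite ler_norml => /andP[h1 h2].
by case: x => [[]|] /=; rewrite ?divr_ge0//; lra.
Qed.

Lemma step_law_ge0 h x : 0 <= step_law p h x.
Proof.
have r0 := recall_law_ge0 h.
by case: x => [b|]; rewrite /step_law addr_ge0// ?exprn_ge0// mulr_ge0// mulr_ge0.
Qed.

Lemma le_mean_step h f g : (forall x, f x <= g x) -> mean h f <= mean h g.
Proof. by move=> fg; apply: ler_sum => x _; rewrite ler_wpM2l// step_law_ge0. Qed.

(** The condition is imposed on the strict prefixes only, so that the indicator of
    this event is known one step ahead and a potential cut off by it remains a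
    supermartingale. *)
Definition always_from N (C : pred (seq (option bool))) h :=
  all (fun k => (N <= k)%N ==> C (take k h)) (iota 0 (size h)).

Lemma always_rcons N C h x : always_from N C (rcons h x) =
  always_from N C h && ((N <= size h)%N ==> C h).
Proof.
rewrite /always_from size_rcons -addn1 iotaD all_cat /= andbT add0n.
rewrite -cats1 take_size_cat//; congr (_ && _).
by apply: eq_in_all => k; rewrite mem_iota add0n /= => kh; rewrite takel_cat// ltnW.
Qed.

Definition low h := z h < 3^-1.

(** Up to the factor [(n - 1) / n], the inverse of the frequency of non-zero
    steps, as long as this frequency stays low. *)
Definition idle_potential N h : R :=
  if always_from N low h then (size h).-1%:R / moves h else 0.

Lemma idle_potential_ge0 N h : 0 <= idle_potential N h.
Proof. by rewrite /idle_potential; case: ifP => // _; rewrite divr_ge0 ?moves_ge0. Qed.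

(** While [z < 1 / 3], the activity exceeds [3 / 2 * z], so the mean number of new
    non-zero steps is at least [3 / 2 * Z / n]. As [Z >= 2], this is at least
    [(Z + 1) / n], which is exactly what makes [(n - 1) / Z] decrease in the
    mean. *)
Lemma idle_supermartingale h N : (2 <= size h)%N -> valid h -> (N <= size h)%N ->
  mean h (fun x => idle_potential N (rcons h x)) <= idle_potential N h.
Proof.
move=> h2 vh Nh; set n : R := (size h)%:R.
rewrite /idle_potential; have n2 : 2 <= n by rewrite ler_nat.
have M2 := moves_ge2 vh.
have [/andP[ah lh]|nl] := boolP (always_from N low h && low h); last first.
  rewrite [leLHS](_ : _ = 0).
    by case: ifP => // _; rewrite divr_ge0 ?moves_ge0.
  rewrite /mean big1// => x _; rewrite always_rcons Nh.
  by rewrite implyTb (negbTE nl) mulr0.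
rewrite ah (@mean_affine h (n / moves h) 0 (n / (moves h + 1) - n / moves h)); last first.
  move=> x; rewrite always_rcons ah Nh lh /= size_rcons moves_rcons /= -/n.
  by case: x => [[]|] /=; rewrite ?normrN ?normr1 ?normr0 ?addr0 ?mulr0 ?addr0 ?mulr1;
    rewrite ?mul0r ?mulrN1; lra.
have act : (moves h + 1) / n <= activity h.
  apply: le_trans (activity_ge h).
  have zE : moves h = z h * n by rewrite /move_freq divfK//; rewrite gt_eqF//; lra.
  rewrite ler_pdivrMr; last by lra.
  have : 3 / 2 * z h <= 2 * z h - 3 / 2 * z h ^+ 2.
    have : 0 <= z h * (3^-1 - z h); last by lra.
    by have [/andP[z0 _] _] := freq_bounds h; rewrite mulr_ge0// subr_ge0 ltW.
  have n0 : 0 <= n by lra.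
  have M2' : 2 <= z h * n by rewrite -zE.
  by move=> /(ler_wpM2r n0); rewrite zE; lra.
rewrite (_ : (size h).-1%:R = n - 1); last first.
  by rewrite /n -[in RHS](prednK (ltnW h2)) -addn1 natrD addrK.
rewrite mul0r addr0.
have -> : n / (moves h + 1) - n / moves h = - (n / (moves h * (moves h + 1))).
  by field; apply/andP; split; rewrite gt_eqF//; lra.
have : n / (moves h * (moves h + 1)) * ((moves h + 1) / n) <=
       n / (moves h * (moves h + 1)) * activity h.
  by rewrite ler_wpM2l// divr_ge0 ?mulr_ge0//; lra.
rewrite [leLHS](_ : _ = (moves h)^-1).
  by rewrite mulrBl mul1r mulNr; set u := _ * activity h; lra.
by field; do !(apply/andP; split); rewrite gt_eqF//; lra.
Qed.

(** A regularly growing weight of order [n ^ c], given by a product so that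
    real powers are avoided and [1 / (n * growth n)] telescopes. *)
Definition growth (c : R) n : R := \prod_(k < n) (1 + c / k%:R).

Lemma growthS c n : growth c n.+1 = growth c n * (1 + c / n%:R).
Proof. by rewrite /growth big_ord_recr. Qed.

Lemma growth_ge1 c n : 0 <= c -> 1 <= growth c n.
Proof.
move=> c0; elim: n => [|n IH]; first by rewrite /growth big_ord0.
by rewrite growthS -[leLHS]mulr1 ler_pM// lerDl divr_ge0.
Qed.

Section escape.
Variables (delta : R) (N : nat).
Hypothesis delta0 : 0 < delta.

Let K := 16 / delta.
Let c := delta / 64.

(** The noise does not degenerate, and the position grows on average faster than
    the square root of time. *)
Definition outward h := (2^-1 <= z h) && (2^-1 + delta <= bias h).

(** In the scale of [r = S ^ 2 / n], this is [growth n / (K + r)]. Diffusion pushes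
    [r] away from 0 and the drift makes [r] grow when it is large; for a large
    constant [K] both effects make [1 / (K + r)] decrease at a relative rate
    [c / n], which leaves room for the growing weight. *)
Definition escape_potential h : R :=
  if always_from N outward h
  then growth c (size h) * ((size h)%:R / (K * (size h)%:R + pos h ^+ 2)) else 0.

Let K0 : 0 < K. Proof. by rewrite divr_gt0. Qed.
Let c0 : 0 < c. Proof. by rewrite divr_gt0. Qed.

Lemma escape_potential_ge0 h : 0 <= escape_potential h.
Proof.
rewrite /escape_potential; case: ifP => // _.
rewrite mulr_ge0 ?(le_trans ler01 (growth_ge1 _ (ltW c0)))//.
by rewrite divr_ge0// addr_ge0 ?sqr_ge0// mulr_ge0// ltW.
Qed.

Lemma inv1D_le (t : R) : - 2^-1 <= t -> (1 + t)^-1 <= 1 - t + 2 * t ^+ 2.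
Proof.
move=> t2; have t1 : 0 < 1 + t by lra.
rewrite -[leLHS]mul1r ler_pdivrMr//.
have : 0 <= t ^+ 2 * (1 + 2 * t) by rewrite mulr_ge0 ?sqr_ge0//; lra.
by lra.
Qed.

(** The inequality behind [escape_supermartingale], with [r] the squared position,
    [m] the activity and [b] the bias. After multiplication by the denominators
    it is quadratic in [n] and [r]: the coefficient of [n ^ 2] is positive because
    [c * K = 1 / 4 < m], that of [r ^ 2] because [1 + c < 2 * b], and the Ito
    correction, of order [n * r], is absorbed since [delta * K = 16]. *)
Lemma escape_drift (n r m b : R) : 8 * (K + 1) ^+ 2 <= n -> 0 <= r ->
  2^-1 <= m <= 1 -> 2^-1 + delta <= b <= 2 -> delta <= 2 ->
  (1 + c) * (K * n + r) ^+ 2 <= n * ((K * n + r) * (K + 2 * b * (r / n) + m) -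
     2 * (K ^+ 2 + 4 * r * m + m + 2 * K * m + 4 * (K + 1) * (b * (r / n)))).
Proof.
move=> nK r0 /andP[m1 m2] /andP[b1 b2] d2.
have d0 := delta0; have K8 : 8 <= K by rewrite /K ler_pdivlMr; lra.
have n0 : 0 < n by apply: lt_le_trans nK; rewrite mulr_gt0// exprn_gt0//; lra.
have dK : delta * K = 16 by rewrite /K mulrCA divff ?mulr1// gt_eqF.
have cK : c * K = 4^-1 by rewrite /c mulrAC dK; lra.
have cd : c <= delta by rewrite /c; lra.
have -> : n * ((K * n + r) * (K + 2 * b * (r / n) + m) -
     2 * (K ^+ 2 + 4 * r * m + m + 2 * K * m + 4 * (K + 1) * (b * (r / n)))) =
   (K * n + r) * (n * (K + m) + 2 * b * r) -
     2 * (n * (K ^+ 2 + m + 2 * K * m) + 4 * n * (r * m) + 4 * (K + 1) * (b * r)).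
  by field; rewrite gt_eqF.
set D := K * n + r; have D0 : 0 <= D by rewrite addr_ge0// mulr_ge0//; lra.
have Kn0 : 0 <= K * n by rewrite mulr_ge0//; lra.
have h1 : D * (n / 4 + delta * r) <= D * (n * (K + m) + 2 * b * r - (1 + c) * D).
  rewrite ler_wpM2l//.
  have : n * 2^-1 <= n * m by rewrite ler_wpM2l// ltW.
  have : (1 + 2 * delta) * r <= 2 * b * r by rewrite ler_wpM2r//; lra.
  have : c * r <= delta * r by rewrite ler_wpM2r.
  have -> : (1 + c) * D = K * n + r + c * K * n + c * r by rewrite /D; ring.
  by rewrite cK; lra.
have h2 : K * n * (n / 4) + K * n * (delta * r) <= D * (n / 4 + delta * r).
  rewrite -mulrDr ler_wpM2r ?addr_ge0// ?mulr_ge0//; try lra.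
  by rewrite /D lerDl.
have h3 : n * (K ^+ 2 + m + 2 * K * m) <= n * (K + 1) ^+ 2.
  rewrite ler_wpM2l//; first exact: ltW.
  have : 2 * K * m <= 2 * K by rewrite -[leRHS]mulr1 ler_wpM2l//; lra.
  by lra.
have h4 : n * (r * m) <= n * r.
  by rewrite ler_wpM2l//; [exact: ltW|rewrite -[leRHS]mulr1 ler_wpM2l].
have h5 : (K + 1) * (b * r) <= (K + 1) * (2 * r).
  by rewrite ler_wpM2l ?ler_wpM2r//; lra.
have h6 : 2 * n * (K + 1) ^+ 2 <= K * n * (n / 4).
  have : n * (8 * (K + 1) ^+ 2) <= n * n by rewrite ler_wpM2l// ltW.
  have : n * n <= K * (n * n) by rewrite ler_peMl ?mulr_ge0//; lra.
  by lra.
have h7 : K * n * (delta * r) = 16 * (n * r) by rewrite -[16]dK; ring.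
have h8 : 2 * (K + 1) * r <= n * r.
  rewrite ler_wpM2r//; apply: le_trans nK; rewrite expr2.
  have : (K + 1) * 1 <= (K + 1) * (K + 1) by rewrite ler_wpM2l//; lra.
  by lra.
rewrite expr2; lra.
Qed.

(** Writing the new denominator as [D * (1 + t)], the bound
    [(1 + t)^-1 <= 1 - t + 2 * t ^ 2] reduces the mean to the first two
    conditional moments of the step, and [escape_drift] compares them. *)
Lemma escape_supermartingale h : (2 <= size h)%N -> valid h -> (N <= size h)%N ->
  8 * (K + 1) ^+ 2 <= (size h)%:R ->
  mean h (fun x => escape_potential (rcons h x)) <= escape_potential h.
Proof.
move=> h2 vh Nh hK; set n : R := (size h)%:R; set S : R := pos h.
have d0 := delta0; have K0' := K0; have c0' := c0.
have n2 : 2 <= n by rewrite ler_nat.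
set W := escape_potential h; rewrite /escape_potential.
have [/andP[ah oh]|nl] := boolP (always_from N outward h && outward h); last first.
  rewrite [leLHS](_ : _ = 0); first exact: escape_potential_ge0.
  rewrite /mean big1// => x _; rewrite always_rcons Nh.
  by rewrite implyTb (negbTE nl) mulr0.
have K8 : 8 * (K + 1) ^+ 2 <= n by [].
have [/andP[z0 z1] _] := freq_bounds h.
have b2 : bias h <= 2.
  have : q * (2 - z h) <= 1 * (2 - z h) by rewrite ler_wpM2r//; move: p1; lra.
  by rewrite /bias; lra.
have [hz hb] := andP oh.
have m2 : 2^-1 <= activity h <= 1.
  rewrite activity_le1 andbT; apply: le_trans (activity_ge h).
  have : 0 <= (1 - z h) * (z h - 2^-1) by rewrite mulr_ge0//; lra.
  by lra.
have dl2 : delta <= 2 by lra.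
have hb2 : 2^-1 + delta <= bias h <= 2 by rewrite hb.
have := escape_drift K8 (sqr_ge0 S) m2 hb2 dl2.
set b := bias h in b2 hb hb2 *; set m := activity h in m2 *.
set D := K * n + S ^+ 2; set E := _ * (K + _ + m) - _.
(* this keeps [t >= - 1 / 2]: twice [K + 2 S v + |v|] plus [K n + S ^ 2] is at
   least [(|S| - 2) ^ 2 + K n - 4] *)
have Kn4 : 4 <= K * n.
  have K1 : 1 * K <= (K + 1) ^+ 2 by rewrite expr2 ler_pM//; lra.
  have K2 : 1 <= (K + 1) ^+ 2 by rewrite expr2 -[leLHS]mulr1 ler_pM//; lra.
  have : 8 <= K * n; last by lra.
  have K16 : 16 / 2 <= K by rewrite /K ler_pdivrMr// mulrAC ler_pdivlMr//; lra.
  have : 8 * 1 <= K * n by rewrite ler_pM//; lra.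
  by lra.
have D0 : 0 < D by rewrite /D; have := sqr_ge0 S; lra.
have n0 : 0 < n by lra.
move=> drift.
have {}drift : (1 + c) / n <= E / D ^+ 2.
  rewrite ler_pdivrMr// mulrAC ler_pdivlMr ?exprn_gt0//.
  by rewrite [leRHS]mulrC.
pose u x := K + 2 * S * val x + `|val x|.
pose g x := (n + 1) / D * (1 - u x / D + 2 * (u x / D) ^+ 2).
have ub x : - 2^-1 <= u x / D.
  rewrite ler_pdivlMr// /D /u.
  have := sqr_ge0 (S - 2); have := sqr_ge0 (S + 2); move: K8.
  by case: x => [[]|] /=; rewrite ?normrN ?normr1 ?normr0; lra.
rewrite /W /escape_potential ah -/n -/S -/D.
apply: (@le_trans _ _ (mean h (fun x => growth c (size h) * (1 + c / n) * g x))).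
  apply: le_mean_step => x.
  rewrite always_rcons ah Nh oh /= size_rcons growthS pos_rcons -/n -/S.
  rewrite -[(size h).+1]addn1 natrD -/n.
  rewrite ler_wpM2l//.
    rewrite mulr_ge0 ?(le_trans ler01 (growth_ge1 _ (ltW c0)))//.
    by rewrite addr_ge0// divr_ge0// ltW.
  rewrite (_ : K * (n + 1) + _ = D * (1 + u x / D)); last first.
    rewrite [RHS]mulrDr mulr1 [D * (_ / D)]mulrCA divff ?mulr1 ?gt_eqF//.
    by rewrite sqrrD sqr_val /D /u; ring.
  rewrite invfM mulrA ler_wpM2l//; first by rewrite divr_ge0//; lra.
  exact: inv1D_le.
rewrite meanZ (@mean_affine h ((n + 1) / D * (1 - K / D + 2 * K ^+ 2 / D ^+ 2))
  ((n + 1) / D * (- (2 * S) / D + 8 * S * (K + 1) / D ^+ 2))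
  ((n + 1) / D * (- 1 / D + 2 * (4 * S ^+ 2 + 1 + 2 * K) / D ^+ 2))); last first.
  move=> x; rewrite /g /u.
  by case: x => [[]|] /=; rewrite ?normrN ?normr1 ?normr0; field; rewrite gt_eqF.
rewrite -/b -/m -mulrA ler_wpM2l ?(le_trans ler01 (growth_ge1 _ (ltW c0)))//.
rewrite (_ : _ + _ * m = (n + 1) / D * (1 - E / D ^+ 2)); last first.
  rewrite /E /D /pos_freq -/S -/n; field.
  by rewrite !gt_eqF.
rewrite mulrA [leRHS]mulrC.
apply: (@le_trans _ _ ((1 + c / n) * ((n + 1) / D) * (1 - (1 + c) / n))).
  rewrite ler_wpM2l//; last by lra.
  by rewrite mulr_ge0// ?divr_ge0//; [rewrite addr_ge0// divr_ge0// ltW|lra|exact: ltW].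
rewrite (_ : _ * _ = D^-1 * (((n + c) * (n + 1) * (n - 1 - c)) / n ^+ 2)); last first.
  by field; rewrite !gt_eqF.
rewrite ler_wpM2l ?invr_ge0 ?(ltW D0)// ler_pdivrMr ?exprn_gt0//.
have : 0 <= c ^+ 2 * n + c * n + c * (1 + c) + n.
  by rewrite !addr_ge0// ?mulr_ge0 ?exprn_ge0// ltW//; lra.
by lra.
Qed.

End escape.

End drift.

(** * Telescoping weights *)

Section weights.
Context {R : realType}.

Lemma growth_ge_harm (c : R) n : 0 <= c -> c * harm n <= growth c n.
Proof.
move=> c0; apply: (@le_trans _ _ (1 + c * harm n)); first by rewrite lerDr.
elim: n => [|n IH]; first by rewrite /harm /growth !big_ord0 mulr0 addr0.
rewrite growthS harmS mulrDr addrA mulrDr mulr1 lerD//.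
by rewrite -[leLHS]mul1r ler_wpM2r ?divr_ge0// growth_ge1.
Qed.

(** The bound for [1 / S ^ 2] obtained from the escape potential. *)
Definition escape_weight (c : R) n : R := (n%:R * growth c n)^-1.

Definition escape_tail (c : R) n : R := (1 + c) / c * (growth c n)^-1.

Lemma escape_weight_ge0 c n : 0 <= c -> 0 <= escape_weight c n.
Proof.
by move=> c0; rewrite invr_ge0 mulr_ge0// (le_trans ler01)// growth_ge1.
Qed.

Lemma escape_tail_ge0 c n : 0 < c -> 0 <= escape_tail c n.
Proof.
move=> c0; rewrite mulr_ge0 ?invr_ge0 ?(le_trans ler01 (growth_ge1 _ (ltW c0)))//.
by rewrite divr_ge0// ?ltW// ltr_wpDl// ltW.
Qed.

Lemma escape_weight_le c n : 0 < c -> (1 <= n)%N ->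
  escape_weight c n <= escape_tail c n - escape_tail c n.+1.
Proof.
move=> c0 n1; rewrite /escape_weight /escape_tail growthS.
have w1 := growth_ge1 n (ltW c0); set w := growth c n in w1 *.
have m1 : 1 <= n%:R :> R by rewrite ler1n.
set m : R := n%:R in m1 *.
rewrite (_ : _ - _ = (1 + c) / (w * (m + c))); last first.
  by field; rewrite !gt_eqF//; lra.
rewrite invfM ler_pdivlMr ?mulr_gt0//; try lra.
rewrite (_ : _ * _ = 1 + c / m); last by field; rewrite !gt_eqF//; lra.
by rewrite lerD2l ler_pdivrMr ?ler_peMr//; lra.
Qed.

Lemma escape_tail_cvg0 c : 0 < c -> escape_tail c n @[n --> \oo] --> (0 : R).
Proof.
move=> c0; rewrite -(mulr0 ((1 + c) / c)); apply: cvgM; first exact: cvg_cst.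
apply/cvgrPdist_le => e e0; have [N HN] := harm_unbounded (c^-1 * e^-1).
exists N => // n /= /HN Hn; rewrite sub0r normrN ger0_norm.
  rewrite -[e]invrK lef_pV2 ?posrE ?invr_gt0//.
    apply: le_trans (growth_ge_harm n (ltW c0)).
    by rewrite mulrC -ler_pdivrMr// mulrC.
  by apply: lt_le_trans (growth_ge1 _ (ltW c0)).
by rewrite invr_ge0 (le_trans ler01 (growth_ge1 _ (ltW c0))).
Qed.

Lemma tele_sum_cvg (b r : nat -> R) N :
  (forall n, (N <= n)%N -> 0 <= b n <= r n - r n.+1) -> (forall n, (N <= n)%N -> 0 <= r n) ->
  cvgn (fun n => \sum_(k < n) b k).
Proof.
move=> br r0.
suff : cvgn (fun n => \sum_(k < n + N) b k).
  move=> /cvg_ex[s vs]; apply/cvg_ex; exists s.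
  by rewrite -(cvg_shiftn N).
apply: nondecreasing_is_cvgn.
  apply/nondecreasing_seqP => n; rewrite addSn big_ord_recr/= lerDl.
  by have /andP[] := br (n + N)%N (leq_addl _ _).
exists (\sum_(k < N) b k + r N) => _ [n _ <-].
have H k : (N <= k < n + N)%N ->
   - r k.+1 - - r k >= \sum_(i < k.+1) b i - \sum_(i < k) b i.
  move=> /andP[Nk _]; rewrite big_ord_recr/= addrAC subrr add0r.
  by have /andP[_] := br k Nk; lra.
have := @le_sum_increments R (fun n => - r n) (fun n => \sum_(k < n) b k) N _
  (leq_addl n N) H.
by have := r0 (n + N)%N (leq_addl _ _); lra.
Qed.

(** A telescoping form of the convergence of the sum of [n ^ (- 1 - d)]: the
    factor [exp (- d * harm n)] plays the role of [n ^ (- d)]. *)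
Lemma exp_harm_le (d : R) n : 0 < d -> (1 <= n)%N ->
  expR (- (d * harm n)) / n%:R <=
  (1 + d) / d * expR (- (d * harm n)) - (1 + d) / d * expR (- (d * harm n.+1)).
Proof.
move=> d0 n1; pose v n := expR (- (d * harm n)) : R; rewrite -!/(v _).
have vS : v n.+1 = v n * expR (- (d / n%:R)) by rewrite /v harmS mulrDr opprD expRD.
rewrite -mulrBr vS -[X in X - _]mulr1 -mulrBr mulrCA ler_wpM2l ?expR_ge0//.
have m1 : 1 <= n%:R :> R by rewrite ler1n.
set m : R := n%:R in m1 *.
have e1 : expR (- (d / m)) <= (1 + d / m)^-1.
  rewrite expRN lef_pV2 ?posrE ?expR_gt0 ?expR_ge1Dx//.
  by rewrite ltr_wpDr// divr_ge0//; lra.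
apply: (@le_trans _ _ ((1 + d) / d * (1 - (1 + d / m)^-1))); last first.
  by rewrite ler_wpM2l ?lerD2l ?lerN2// divr_ge0//; lra.
rewrite (_ : _ * _ = (1 + d) / (m + d)); last by field; rewrite !gt_eqF//; lra.
by rewrite ler_pdivlMr ?ler_pdivrMl//; nra.
Qed.

Lemma ln_ratio_cvg (y : nat -> R) (a : R) :
  (forall e, 0 < e -> exists C N, forall n, (N <= n)%N ->
    (a - e) * ln n%:R - C <= y n <= a * ln n%:R + C) ->
  y n / ln n%:R @[n --> \oo] --> a.
Proof.
move=> H; apply/cvgrPdist_le => e e0.
have e2 : 0 < e / 2 by rewrite divr_gt0.
have [C [N HN]] := H _ e2; have [M HM] := ln_unbounded (1 + `|C| * (2 / e)).
exists (maxn N M) => // n /=; rewrite geq_max => /andP[/HN /andP[h1 h2] /HM h3].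
have l0 : 0 < ln n%:R :> R.
  by apply: lt_le_trans h3; rewrite ltr_pwDl// mulr_ge0// divr_ge0// ltW.
have : C <= e / 2 * ln n%:R.
  apply: le_trans (ler_norm _) _; rewrite -ler_pdivrMl// invf_div mulrC.
  by apply: le_trans h3; rewrite lerDr.
move: l0 h1 h2; set l := ln _ => l0 h1 h2 h4.
rewrite ler_distlC; apply/andP; split.
  by rewrite ler_pdivlMr//; lra.
rewrite ler_pdivrMr//; have : 0 <= e / 2 * l by rewrite mulr_ge0 ?ltW.
lra.
Qed.

End weights.

(** * Growth along a regular path *)

Section path.
Context {R : realType} (p : R) (x : nat -> option bool).
Hypotheses (p0 : 0 < p) (p1 : p < 1) (p38 : 3 / 8 < 2 * p - 1).
Local Notation q := (2 * p - 1).
Local Notation val := (@val_of R).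
Local Notation h n := (mkseq x n).
Local Notation S n := (pos (h n) : R).
Local Notation Z n := (moves (h n) : R).
Local Notation z n := (move_freq (h n) : R).
Local Notation s n := (pos_freq (h n) : R).
Local Notation xi f k := (noise (step_law p) f (h k) (x k)).
Local Notation norm_val := (fun a => `|val a|).

Lemma path_pos n : S n.+1 = S n + val (x n).
Proof. by rewrite mkseqS pos_rcons. Qed.

Lemma path_moves n : Z n.+1 = Z n + `|val (x n)|.
Proof. by rewrite mkseqS moves_rcons. Qed.

(** The Doob decomposition of a step. *)
Lemma xi_val k : val (x k) = bias p (h k) * s k + xi val k.
Proof. by rewrite /noise mean_val addrC subrK. Qed.

Lemma xi_norm k : `|val (x k)| = activity p (h k) + xi norm_val k.
Proof. by rewrite /noise mean_norm_val addrC subrK. Qed.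

(** The weight [1 / k.+1] is that of a new step in the frequencies at time
    [k.+1]. *)
Definition freq_noise (f : option bool -> R) n := \sum_(k < n) k.+1%:R^-1 * xi f k.

Lemma freq_noiseS f n : freq_noise f n.+1 - freq_noise f n = xi f n / n.+1%:R.
Proof. by rewrite /freq_noise big_ord_recr/= addrAC subrr add0r mulrC. Qed.

Lemma freq_step (u : R) n : (1 <= n)%N -> forall y : R,
  (u + y) / n.+1%:R = u / n%:R + (y - u / n%:R) / n.+1%:R.
Proof.
move=> n1 y; have : 1 <= n%:R :> R by rewrite ler1n.
by rewrite -addn1 natrD => ?; field; rewrite !gt_eqF//; lra.
Qed.

Lemma path_pos_freq n : (1 <= n)%N -> s n.+1 =
  s n + (bias p (h n) - 1) * s n / n.+1%:R + (freq_noise val n.+1 - freq_noise val n).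
Proof.
move=> n1; rewrite freq_noiseS /pos_freq !size_mkseq path_pos freq_step// xi_val.
by rewrite /pos_freq size_mkseq; set i := n.+1%:R^-1; set u := S n / _; ring.
Qed.

Lemma path_move_freq n : (1 <= n)%N -> z n.+1 = z n +
  (activity p (h n) - z n) / n.+1%:R + (freq_noise norm_val n.+1 - freq_noise norm_val n).
Proof.
move=> n1; rewrite freq_noiseS /move_freq !size_mkseq path_moves freq_step// xi_norm.
by set i := n.+1%:R^-1; set u := Z n / _; ring.
Qed.

Hypothesis cvg_val : cvgn (freq_noise val).
Hypothesis cvg_norm : cvgn (freq_noise norm_val).
Hypothesis active : exists2 c : R, 0 < c & forall N, exists2 n, (N <= n)%N & c <= z n.

Lemma activity_drift n : `|activity p (h n) - z n| <= 1.
Proof.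
have [/andP[z0 z1] _] := freq_bounds (R := R) (h n).
have a1 := activity_le1 p0 p1 (h n); have := activity_ge p (h n).
have : 0 <= z n * (1 - z n) by rewrite mulr_ge0// subr_ge0.
by rewrite ler_norml => ? ?; apply/andP; split; lra.
Qed.

Lemma move_freq_ge (eta : R) : 0 < eta ->
  exists N, forall n, (N <= n)%N -> 2 / 3 - eta <= z n.
Proof.
apply: (@logistic_liminf R (fun n => z n) _ (fun n => activity p (h n) - z n) 1 1
  cvg_norm) => //.
- by move=> n n1; rewrite path_move_freq.
- by move=> n _; exact: activity_drift.
- by move=> n _ _; have := activity_ge p (h n); lra.
Qed.

Section subballistic.
Hypothesis q34 : q < 3 / 4.

(** Since [z] is eventually at least about [2 / 3], the bias is at most about
    [4 q / 3], which is below 1. *)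
Lemma bias_lt1 : exists2 delta : R, 0 < delta &
  exists N, forall n, (N <= n)%N -> bias p (h n) - 1 <= - delta.
Proof.
move: p38 q34 => q38 q34'; exists ((1 - 4 / 3 * q) / 2); first by lra.
have e0 : 0 < (1 - 4 / 3 * q) / 2 by lra.
have [N HN] := move_freq_ge e0; exists N => n Nn.
have zn := HN n Nn; rewrite /bias.
have : q * (2 - z n) <= q * (4 / 3 + (1 - 4 / 3 * q) / 2) by rewrite ler_wpM2l//; lra.
have : q * ((1 - 4 / 3 * q) / 2) <= 1 * ((1 - 4 / 3 * q) / 2) by rewrite ler_wpM2r//; lra.
by lra.
Qed.

Lemma pos_freq_cvg0 : s n @[n --> \oo] --> (0 : R).
Proof.
have [delta d0 [N HN]] := bias_lt1.
apply: (@contraction_cvg0 R (fun n => s n) _ (fun n => bias p (h n) - 1) 3 delta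
  (maxn 1 N) cvg_val d0) => n; rewrite geq_max => /andP[n1 Nn].
- exact: path_pos_freq.
- have [/andP[z0 z1] sz] := freq_bounds (R := R) (h n).
  rewrite normrM -[leRHS]mulr1 ler_pM//; last by lra.
  rewrite /bias ler_norml; move: p38 p1 => q38 q1.
  have : q * (2 - z n) <= 1 * (2 - z n) by rewrite ler_wpM2r//; lra.
  have : 0 <= q * (2 - z n) by rewrite mulr_ge0//; lra.
  by move=> ? ?; apply/andP; split; lra.
- exact: HN.
Qed.

(** The position feeds the activity only through [s ^ 2], which tends to 0, so the
    logistic recursion is asymptotically autonomous. *)
Lemma move_freq_cvg : z n @[n --> \oo] --> (2 / 3 : R).
Proof.
apply/cvgrPdist_le => e e0; have [N1 HN1] := move_freq_ge e0.
have h0 : (q ^+ 2 * s n ^+ 2 / 2) @[n --> \oo] --> (0 : R).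
  rewrite [X in _ --> X](_ : 0 = q ^+ 2 * (0 * 0) / 2 :> R); last by lra.
  apply: cvgM; [|exact: cvg_cst]; apply: cvgM; [exact: cvg_cst|].
  by apply: cvgM; exact: pos_freq_cvg0.
have [|||N2 HN2] := @logistic_limsup R (fun n => z n) (freq_noise norm_val)
  (fun n => activity p (h n) - z n) (fun n => q ^+ 2 * s n ^+ 2 / 2) 1 1 cvg_norm
  _ _ _ h0 e e0.
- by move=> n n1; rewrite path_move_freq.
- by move=> n _; exact: activity_drift.
- by move=> n _; rewrite /activity; lra.
exists (maxn N1 N2) => // n /=; rewrite geq_max => /andP[/HN1 ? /HN2 ?].
by rewrite ler_norml; apply/andP; split; lra.
Qed.

End subballistic.

(** Half of [4 q / 3 - 1 / 2], the excess over [1 / 2] of the bias at [z = 2 / 3];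
    for [q >= 3 / 4] it is also at most [q - 1 / 2]. *)
Definition margin : R := (8 * q - 3) / 12.

(** For [q < 3 / 4] the bias tends to [4 q / 3]; for [q >= 3 / 4] the bound
    [z <= 1] already makes the bias at least [q]. *)
Lemma eventually_outward :
  exists N, forall n, (N <= n)%N -> outward p margin (h n).
Proof.
have e0 : 0 < 6^-1 :> R by [].
have [N1 HN1] := move_freq_ge e0.
have mq := p38; have [q34|q34] := ltP q (3 / 4).
  have m0 : 0 < margin by rewrite /margin; lra.
  have [N2 _ HN2] := (cvgrPdist_le _ _).1 (move_freq_cvg q34) _ m0.
  exists (maxn N1 N2) => n; rewrite geq_max => /andP[/HN1 zn /HN2].
  rewrite /= ler_norml => /andP[z1 z2].
  rewrite /outward /bias; apply/andP; split; first by lra.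
  have : q * (4 / 3 - margin) <= q * (2 - z n) by rewrite ler_wpM2l//; lra.
  have : q * margin <= 1 * margin by rewrite ler_wpM2r//; lra.
  by rewrite /margin; lra.
exists N1 => n /HN1 zn; rewrite /outward /bias; apply/andP; split; first by lra.
have [/andP[z0 z1] _] := freq_bounds (R := R) (h n).
have : q * 1 <= q * (2 - z n) by rewrite ler_wpM2l//; lra.
by rewrite /margin; lra.
Qed.

Lemma margin_gt0 : 0 < margin.
Proof. by move: p38 => ?; rewrite /margin; lra. Qed.

Definition rate : R := margin / 64.

Lemma rate_gt0 : 0 < rate.
Proof. by rewrite divr_gt0// margin_gt0. Qed.

Hypothesis escaped : exists2 B : R, 0 < B & exists N, forall n, (N <= n)%N ->
  n%:R * growth rate n <= B * S n ^+ 2.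
Hypothesis cvg_pos : cvgn (fun n => \sum_(k < n) (S k)^-1 * xi val k).
Hypothesis cvg_moves : cvgn (fun n => \sum_(k < n) (Z k)^-1 * xi norm_val k).

Lemma growth_gt0 n : 0 < growth rate n.
Proof. by rewrite (lt_le_trans ltr01)// growth_ge1// ltW// rate_gt0. Qed.

Lemma pos_sqr_gt0 : exists N, forall n, (N <= n)%N -> 0 < S n ^+ 2.
Proof.
have [B B0 [N HN]] := escaped; exists (maxn 1 N) => n; rewrite geq_max => /andP[n1 Nn].
rewrite -(pmulr_rgt0 _ B0); apply: lt_le_trans (HN n Nn).
by rewrite mulr_gt0 ?ltr0n// growth_gt0.
Qed.

(** The relative increment of the position is [bias / n] plus the noise divided by
    [S], whose series converges; its square is summable by the escape bound. *)
Lemma ln_pos_cvg : cvgn (fun n => ln `|S n| - \sum_(k < n) bias p (h k) / k%:R).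
Proof.
have [B B0 [N HN]] := escaped; have [M HM] := pos_sqr_gt0.
pose N' := maxn 1 (maxn N M).
have H : cvgn (fun n => ln `|S n| - \sum_(k < n) val (x k) / S k).
  apply: (@ln_sum_cvg R _ (fun n => val (x n)) (escape_weight rate) (escape_tail rate) B N').
  - exact: ltW.
  - move=> n; rewrite geq_max => /andP[n1 _].
    by apply: escape_weight_le => //; exact: rate_gt0.
  - exact: escape_tail_cvg0 rate_gt0.
  - move=> n; rewrite !geq_max => /and3P[_ _ /HM].
    by apply: contraTneq => ->; rewrite expr0n ltxx.
  - by move=> n _; exact: path_pos.
  - move=> n; rewrite !geq_max => /and3P[n1 Nn Mn].
    rewrite exprMn exprVn; apply: (@le_trans _ _ (S n ^+ 2)^-1).
      by rewrite ler_piMl ?invr_ge0 ?sqr_ge0// sqr_val norm_val_le1.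
    have S0 := HM _ Mn.
    have G0 : 0 < n%:R * growth rate n by rewrite mulr_gt0 ?ltr0n// growth_gt0.
    by rewrite ler_pdivlMr// mulrC ler_pdivrMr// HN.
apply: (cvgn_of_eq_increments (N := N')) (is_cvgD H cvg_pos) => n.
rewrite !geq_max => /and3P[n1 Nn Mn]; rewrite !fctE !big_ord_recr/=.
have S0 : S n != 0.
  by have := HM _ Mn; apply: contraTneq => ->; rewrite expr0n ltxx.
have n0 : n%:R != 0 :> R by rewrite pnatr_eq0 -lt0n.
have -> : val (x n) / S n = bias p (h n) / n%:R + (S n)^-1 * xi val n.
  rewrite {1}xi_val /pos_freq size_mkseq; field.
  by rewrite n0 S0.
by set u := bias _ _ / _; lra.
Qed.

Lemma path_size_moves n : Z n = z n * n%:R.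
Proof.
rewrite /move_freq size_mkseq; case: n => [|n]; last by rewrite divfK.
by rewrite mulr0 /moves /= big_nil.
Qed.

Lemma move_freq_ge_half : exists N, forall n, (N <= n)%N -> 2^-1 <= z n.
Proof.
have [|N HN] := @move_freq_ge 6^-1; first by [].
by exists N => n /HN; lra.
Qed.

(** The conditional relative growth [n * activity / Z] of the number of non-zero
    steps. *)
Definition moves_rate n : R := 2 - 3 / 2 * z n + q ^+ 2 * s n ^+ 2 / (2 * z n).

Lemma ln_moves_cvg : cvgn (fun n => ln (Z n) - \sum_(k < n) moves_rate k / k%:R).
Proof.
have [N HN] := move_freq_ge_half.
pose N' := maxn 1 N.
have Z0 n : (N' <= n)%N -> 2^-1 * n%:R <= Z n.
  by rewrite geq_max => /andP[n1 /HN zn]; rewrite path_size_moves ler_wpM2r.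
have H : cvgn (fun n => ln `|Z n| - \sum_(k < n) `|val (x k)| / Z k).
  apply: (@ln_sum_cvg R _ (fun n => `|val (x n)|) (fun n => n%:R^-1 ^+ 2)
    (fun n => 2 / n%:R) 4 N').
  - by [].
  - by move=> n; rewrite geq_max => /andP[n1 _]; exact: sqr_inv_le.
  - by rewrite -(mulr0 2); apply: cvgM; [exact: cvg_cst|exact: invn_cvg0].
  - move=> n nN; have := Z0 _ nN; move: nN; rewrite geq_max => /andP[n1 _] Zn.
    by rewrite gt_eqF// (lt_le_trans _ Zn)// mulr_gt0// ltr0n.
  - by move=> n _; exact: path_moves.
  - move=> n nN; have := Z0 _ nN; move: nN; rewrite geq_max => /andP[n1 _] Zn.
    have n0 : 0 < n%:R :> R by rewrite ltr0n.
    rewrite (_ : 4 * _ = (2 * n%:R^-1) ^+ 2); last by rewrite exprMn expr2; lra.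
    rewrite lerXn2r ?nnegrE ?divr_ge0 ?moves_ge0//.
    rewrite -[leRHS]mul1r ler_pM ?invr_ge0 ?moves_ge0 ?norm_val_le1//.
    rewrite -[leRHS]invrK lef_pV2 ?posrE ?invr_gt0 ?mulr_gt0 ?invr_gt0//; last first.
      by rewrite (lt_le_trans _ Zn)// mulr_gt0.
    by rewrite invfM invrK.
apply: (cvgn_of_eq_increments (N := N')) (is_cvgD H cvg_moves) => n nN.
have := Z0 _ nN; move: nN; rewrite geq_max => /andP[n1 /HN zn] Zn.
rewrite !fctE !big_ord_recr/= !(ger0_norm (moves_ge0 _)).
have n0 : 0 < n%:R :> R by rewrite ltr0n.
have -> : `|val (x n)| / Z n = moves_rate n / n%:R + (Z n)^-1 * xi norm_val n.
  rewrite {1}xi_norm /activity /moves_rate path_size_moves; field.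
  by rewrite !gt_eqF//; lra.
by set u := moves_rate _ / _; lra.
Qed.

Lemma ln_harm_cvg : cvgn (fun n => ln n%:R - harm n : R).
Proof.
have H : cvgn (fun n => ln `|n%:R : R| - \sum_(k < n) 1 / k%:R).
  apply: (@ln_sum_cvg R _ (fun n => 1) (fun n => n%:R^-1 ^+ 2) (fun n => 2 / n%:R) 1 1).
  - by [].
  - exact: sqr_inv_le.
  - by rewrite -(mulr0 2); apply: cvgM; [exact: cvg_cst|exact: invn_cvg0].
  - by move=> n n1; rewrite pnatr_eq0 -lt0n.
  - by move=> n _; rewrite -addn1 natrD.
  - by move=> n _; rewrite !mul1r.
apply: (cvgn_of_eq_increments (N := 1)) H => n n1.
rewrite !normr_nat !harmS big_ord_recr/=.
by rewrite div1r; lra.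
Qed.

Definition defect n : R := q ^+ 3 / 3 * (s n ^+ 2 / z n).

(** The combination of logarithms in which the fluctuations of [z] cancel: to first
    order in [z], the growth rates of [ln `|S|] and of [2 q / 3 * ln Z] have the same
    slope, and what remains is the rate [- defect], which only feels the
    position. *)
Definition balance n : R := ln `|S n| - 2 * q / 3 * ln (Z n) - 2 * q / 3 * ln n%:R.

(** The identity
    [bias - 2 q / 3 * moves_rate - 2 q / 3 = - defect] combines the expansions of
    the three logarithms. *)
Lemma balance_cvg : cvgn (fun n => balance n + \sum_(k < n) defect k / k%:R).
Proof.
have [N HN] := move_freq_ge_half.
apply: (cvgn_of_eq_increments (N := maxn 1 N)) (is_cvgB (is_cvgB ln_pos_cvg
  (is_cvgM (is_cvg_cst (2 * q / 3)) ln_moves_cvg))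
  (is_cvgM (is_cvg_cst (2 * q / 3)) ln_harm_cvg)) => n.
rewrite geq_max => /andP[n1 /HN zn].
rewrite !fctE /balance /= !big_ord_recr/= !harmS.
have n0 : 0 < n%:R :> R by rewrite ltr0n.
have -> : defect n / n%:R = 2 * q / 3 * (moves_rate n / n%:R) + 2 * q / 3 * n%:R^-1
    - bias p (h n) / n%:R.
  rewrite /defect /moves_rate /bias; field.
  by rewrite !gt_eqF//; lra.
by set u := bias _ _ / _; set v := moves_rate n / _; set i := n%:R^-1; lra.
Qed.

Lemma cvgn_bounded (u : nat -> R) : cvgn u -> exists M : R, forall n, `|u n| <= M.
Proof.
move=> /cvg_seq_bounded[M [_ HM]]; exists (M + 1) => n.
by apply: HM => //; rewrite ltrDl.
Qed.

Lemma norm_pos_freq n : 0 < S n ^+ 2 -> (0 < n)%N -> `|s n| = expR (ln `|S n| - ln n%:R).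
Proof.
move=> S0 n0; have S1 : 0 < `|S n|.
  by rewrite normr_gt0; apply: contraTneq S0 => ->; rewrite expr0n ltxx.
rewrite expRD expRN !lnK ?posrE ?ltr0n//.
by rewrite /pos_freq size_mkseq normrM normfV normr_nat.
Qed.

Lemma defect_bounds n : 0 <= defect n <= `|s n|.
Proof.
have [/andP[z0 z1] sz] := freq_bounds (R := R) (h n).
move: p38 p1 => q38 q1.
have q3 : 0 <= q ^+ 3 / 3 <= 1.
  have q30 : 0 <= q ^+ 3 by rewrite exprn_ge0//; lra.
  have : q ^+ 3 <= 1 by rewrite exprn_ile1//; lra.
  by move=> ?; apply/andP; split; lra.
have sz2 : 0 <= s n ^+ 2 / z n <= `|s n|.
  rewrite divr_ge0 ?sqr_ge0//=.
  have [->|z00] := eqVneq (z n) 0; first by rewrite invr0 mulr0.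
  rewrite ler_pdivrMr ?lt_neqAle 1?eq_sym ?z00// -real_normK ?num_real// expr2.
  by rewrite ler_wpM2l.
move/andP: q3 => [q3 q3']; move/andP: sz2 => [s1 s2].
by rewrite /defect mulr_ge0//= -[leRHS]mul1r ler_pM.
Qed.

Section subballistic_growth.
Hypothesis q34 : q < 3 / 4.

(** The logarithm of [`|s|] has drift [bias - 1], eventually below a negative
    constant. *)
Lemma pos_freq_decay : exists d C, 0 < d /\
  exists N, forall n, (N <= n)%N -> `|s n| <= expR C * expR (- (d * harm n)).
Proof.
have [d d0 [N HN]] := bias_lt1 q34; have [N' HN'] := pos_sqr_gt0.
have [M1 HM1] := cvgn_bounded ln_pos_cvg.
have [M2 HM2] := cvgn_bounded ln_harm_cvg.
pose v n := \sum_(k < n) bias p (h k) / k%:R - harm n.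
exists d, (M1 + M2 + v N + d * harm N); split=> //; exists (maxn 1 (maxn N N')) => n.
rewrite !geq_max => /and3P[n1 Nn N'n].
rewrite norm_pos_freq ?HN'// -expRD ler_expR.
have := HM1 n; have := HM2 n; rewrite !ler_norml => /andP[h1 h2] /andP[h3 h4].
suff : v n - v N <= - (d * harm n) - - (d * harm N) by rewrite {1}/v; lra.
apply: (@le_sum_increments R (fun n => - (d * harm n)) v N n Nn) => k /andP[Nk kn].
rewrite /v big_ord_recr/= !harmS.
have : (bias p (h k) - 1) * k%:R^-1 <= - d * k%:R^-1 by rewrite ler_wpM2r// HN.
by set i := k%:R^-1; lra.
Qed.

Lemma defect_sum_cvg : cvgn (fun n => \sum_(k < n) defect k / k%:R).
Proof.
have [d [C [d0 [N HN]]]] := pos_freq_decay.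
pose r n := expR C * ((1 + d) / d * expR (- (d * harm n))) : R.
apply: (@tele_sum_cvg R (fun k => defect k / k%:R) r (maxn 1 N)) => n;
  rewrite geq_max => /andP[n1 Nn].
  have /andP[d1 d2] := defect_bounds n; rewrite divr_ge0//=.
  rewrite -mulrBr; apply: le_trans (ler_wpM2l (expR_ge0 C) (exp_harm_le d0 n1)).
  by rewrite mulrA ler_wpM2r//; apply: le_trans (HN _ Nn).
by rewrite mulr_ge0 ?expR_ge0// mulr_ge0 ?expR_ge0// divr_ge0//; lra.
Qed.

Lemma ln_move_freq_cvg : cvgn (fun n => ln (z n)).
Proof.
apply/cvg_ex; exists (ln (2 / 3)).
by apply: (cvg_comp _ _ (move_freq_cvg q34)); apply: continuous_ln; rewrite divr_gt0.
Qed.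

(** The defects are summable, so [balance] converges; and [ln Z - ln n] converges
    because [z] tends to [2 / 3]. *)
Lemma ln_pos_scale_cvg : cvgn (fun n => ln `|S n| - 4 * q / 3 * ln n%:R).
Proof.
have [N HN] := move_freq_ge_half.
apply: (cvgn_of_eq_increments (N := maxn 1 N)) (is_cvgD (is_cvgB balance_cvg
  defect_sum_cvg) (is_cvgM (is_cvg_cst (2 * q / 3)) ln_move_freq_cvg)) => n.
rewrite geq_max => /andP[n1 Nn].
have E m : (1 <= m)%N -> (N <= m)%N -> ln (Z m) = ln (z m) + ln m%:R.
  move=> m1 /HN zm; rewrite path_size_moves lnM ?posrE ?ltr0n//.
  exact: lt_le_trans zm.
rewrite !fctE /balance (E n)// (E n.+1)//; last exact: leqW.
by rewrite /=; lra.
Qed.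

Lemma ln_pos_ratio_subballistic : ln `|S n| / ln n%:R @[n --> \oo] --> 4 * q / 3.
Proof.
apply: ln_ratio_cvg => e e0; have [M HM] := cvgn_bounded ln_pos_scale_cvg.
exists M, 1%N => n n1; have := HM n; rewrite ler_norml => /andP[h1 h2].
have : 0 <= e * ln n%:R by rewrite mulr_ge0 ?ln_ge0 ?ler1n// ltW.
by move=> ?; apply/andP; split; lra.
Qed.

End subballistic_growth.

Lemma pos_sqr_large (M : R) : exists N, forall n, (N <= n)%N -> M <= S n ^+ 2.
Proof.
have [B B0 [N HN]] := escaped; pose N' := (Num.truncn `|B * M|).+1.
exists (maxn N N') => n; rewrite geq_max => /andP[/HN h1 N'n].
rewrite -(ler_pM2l B0); apply: le_trans h1.
apply: (@le_trans _ _ n%:R); last by rewrite ler_peMr// growth_ge1// ltW// rate_gt0.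
apply: le_trans (ler_norm _) _; apply: (@le_trans _ _ N'%:R).
  exact/ltW/truncnS_gt.
by rewrite ler_nat.
Qed.

Lemma norm_pos_cvgy : `|S n| @[n --> \oo] --> +oo.
Proof.
apply/cvgryPge => M; have [N HN] := pos_sqr_large (M ^+ 2).
exists N => // n /= /HN; rewrite -[X in _ <= X]real_normK ?num_real// => H.
rewrite leNgt; apply/negP => H'; have : `|S n| ^+ 2 < M ^+ 2.
  by rewrite ltrXn2r// ?nnegrE// ltW// (le_lt_trans _ H').
by rewrite ltNge H.
Qed.

(** Steps have size at most 1, so the walk cannot change sign once it stays beyond
    distance 1 from the origin. *)
Lemma sign_stabilizes : exists N, forall n, (N <= n)%N -> S n = Num.sg (S N) * `|S n|.
Proof.
have [N HN] := pos_sqr_large 4; exists N.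
suff H n : (N <= n)%N -> Num.sg (S n) = Num.sg (S N).
  by move=> n Nn; rewrite -(H n)// -numEsg.
elim: n => [|n IH]; first by rewrite leqn0 => /eqP ->.
rewrite leq_eqVlt => /orP[/eqP -> //|]; rewrite ltnS => Nn.
rewrite -IH//; have := HN _ Nn; have := norm_val_le1 (R := R) (x n).
rewrite path_pos ler_norml => /andP[v1 v2] S4.
have [S0|S0|S0] := ltrgt0P (S n).
- have S1 : 1 < S n.
    rewrite ltNge; apply/negP => S1; move: S4; rewrite expr2.
    have : S n * S n <= 1 * 1 by rewrite ler_pM// ltW.
    by lra.
  by rewrite !gtr0_sg//; lra.
- have S1 : S n < - 1.
    rewrite ltNge; apply/negP => S1; move: S4; rewrite expr2.
    have : - S n * - S n <= 1 * 1 by rewrite ler_pM//; lra.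
    by lra.
  by rewrite !ltr0_sg//; lra.
- by move: S4; rewrite S0 expr0n/=; lra.
Qed.

(** The limit is a sign times the exponential of a finite limit, which is why it
    does not vanish. *)
Lemma pos_scale_cvg : q < 3 / 4 ->
  exists2 L : R, L != 0 & S n / n%:R `^ (4 * q / 3) @[n --> \oo] --> L.
Proof.
move=> q34; have /cvg_ex[l Hl] := ln_pos_scale_cvg q34.
have [N HN] := sign_stabilizes; have [M HM] := pos_sqr_large 1.
have S0 n : (M <= n)%N -> S n != 0.
  by move=> /HM; apply: contraTneq => ->; rewrite expr0n/= ler10.
pose K := maxn 1 (maxn N M).
exists (Num.sg (S N) * expR l).
  apply: mulf_neq0; last by rewrite gt_eqF ?expR_gt0.
  rewrite sgr_eq0.
  have MK : (M <= K)%N by rewrite !leq_max leqnn !orbT.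
  have NK : (N <= K)%N by rewrite !leq_max leqnn !orbT.
  by have := S0 _ MK; rewrite (HN _ NK); apply: contra => /eqP ->; rewrite sgr0 mul0r.
have : (Num.sg (S N) * expR (ln `|S n| - 4 * q / 3 * ln n%:R)) @[n --> \oo] -->
    Num.sg (S N) * expR l.
  apply: cvgM; [exact: cvg_cst|].
  by apply: (cvg_comp _ _ Hl); exact: continuous_expR.
apply: cvg_trans; apply: near_eq_cvg; exists K => // n /=.
rewrite !geq_max => /and3P[n1 Nn Mn].
rewrite expRD expRN lnK ?posrE ?normr_gt0 ?S0// mulrA -HN//; congr (_ / _).
by rewrite /powR pnatr_eq0 -[_ == _]negbK -lt0n n1.
Qed.

Section ballistic_growth.
Hypothesis q34 : 3 / 4 <= q.

Lemma ln_pos_le_ln n : 0 < S n ^+ 2 -> (0 < n)%N -> ln `|S n| <= ln n%:R.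
Proof.
move=> S0 n0; rewrite ler_ln ?posrE ?ltr0n//.
  have := moves_le_size (R := R) (h n); rewrite size_mkseq; apply: le_trans.
  exact: norm_pos_le.
by rewrite normr_gt0; apply: contraTneq S0 => ->; rewrite expr0n ltxx.
Qed.

Lemma ln_moves_bounds : exists N, forall n, (N <= n)%N ->
  ln n%:R - ln 2 <= ln (Z n) <= ln n%:R.
Proof.
have [N HN] := move_freq_ge_half; exists (maxn 1 N) => n.
rewrite geq_max => /andP[n1 /HN zn].
have [/andP[z0 z1] _] := freq_bounds (R := R) (h n).
have n0 : 0 < n%:R :> R by rewrite ltr0n.
have zp : 0 < z n by apply: lt_le_trans zn.
rewrite path_size_moves; apply/andP; split.
  have zn2 : n%:R / 2 <= z n * n%:R by rewrite mulrC ler_pM2r.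
  have n2 : 0 < n%:R / 2 :> R by rewrite divr_gt0.
  by rewrite -ln_div ?posrE// ler_ln// posrE mulr_gt0.
have zn1 : z n * n%:R <= n%:R by rewrite ler_piMl// ltW.
by rewrite ler_ln// posrE mulr_gt0.
Qed.

(** The idea is a barrier at [n ^ (1 - e)]. When [`|S|] is below it, [s] is tiny and
    so is the defect, hence [ln `|S| - 2 q / 3 * ln Z] grows at a rate close to
    [2 q / 3] per unit of logarithmic time. This exceeds the rate
    [1 - 2 q / 3 - e] of the barrier, as [4 q / 3 >= 1]. *)
Lemma ln_pos_lower (e : R) : 0 < e -> exists C N, forall n, (N <= n)%N ->
  (1 - e) * ln n%:R - C <= ln `|S n|.
Proof.
move=> e0; move: q34 p1 => q34' q1.
pose k : R := 1 - 2 * q / 3 - e.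
have [M HM] := cvgn_bounded ln_harm_cvg.
have kM n : `|k * (ln n%:R - harm n)| <= `|k| * M by rewrite normrM ler_wpM2l.
have [N1 HN1] := ln_moves_bounds; have [N2 HN2] := pos_sqr_gt0.
have [N3 HN3] := ln_unbounded (e^-1 * (`|k| * M - ln (e / 2))).
pose N := maxn 1 (maxn N1 (maxn N2 N3)).
(* the logarithm of the walk relative to the barrier; its recursion has noise
   [E] and drift [g] *)
pose X n := ln `|S n| - 2 * q / 3 * ln (Z n) - k * harm n.
pose E n := (balance n + \sum_(j < n) defect j / j%:R) +
  2 * q / 3 * (ln n%:R - harm n).
pose g n := (2 * q / 3 - k - defect n) * (n.+1%:R / n%:R).
have cE : cvgn E by apply: is_cvgD balance_cvg (is_cvgM (is_cvg_cst _) ln_harm_cvg).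
have XS n : (N <= n)%N -> X n.+1 = X n + g n / n.+1%:R + (E n.+1 - E n).
  rewrite geq_max => /andP[n1 _].
  have -> : g n / n.+1%:R = (2 * q / 3 - k - defect n) * n%:R^-1.
    by rewrite /g -[LHS]mulrA; congr (_ * _); rewrite mulrAC divff ?mul1r ?pnatr_eq0.
  rewrite /X /E /balance big_ord_recr/= !harmS.
  by move: (n%:R^-1) => i; lra.
have sE n : (N <= n)%N -> 0 < `|S n|.
  rewrite !geq_max => /and4P[_ _ /HN2 S2 _]; rewrite normr_gt0.
  by apply: contraTneq S2 => ->; rewrite expr0n ltxx.
have ratio n : (N <= n)%N -> 1 <= n.+1%:R / n%:R :> R /\ n.+1%:R / n%:R <= 2 :> R.
  rewrite geq_max => /andP[n1 _]; have m1 : 1 <= n%:R :> R by rewrite ler1n.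
  rewrite -addn1 natrD ler_pdivlMr ?ler_pdivrMr ?ltr0n//.
  by split; lra.
have gC n : (N <= n)%N -> `|g n| <= (3 + e) * 2.
  move=> nN; have [r1 r2] := ratio n nN; rewrite normrM ler_pM//; last first.
    by rewrite ger0_norm; lra.
  have /andP[d0 d1] := defect_bounds n.
  have [/andP[z0 z1] sz] := freq_bounds (R := R) (h n).
  by rewrite ler_norml /k; apply/andP; split; lra.
have gd n : (N <= n)%N -> X n <= 0 -> e / 2 <= g n.
  move=> nN Xn; have [r1 r2] := ratio n nN; have /andP[d0 d1] := defect_bounds n.
  have Sn := sE n nN.
  move: nN; rewrite !geq_max => /and4P[n1 /HN1/andP[_ Z1] N2n /HN3 l3].
  suff sn : `|s n| <= e / 2.
    rewrite -[leLHS]mulr1 /g /k ler_pM//; lra.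
  rewrite norm_pos_freq ?HN2// -[leRHS]lnK ?posrE ?divr_gt0// ler_expR.
  have := kM n; rewrite ler_norml => /andP[k1 k2].
  have l4 : `|k| * M - ln (e / 2) <= e * ln n%:R by rewrite -ler_pdivrMl.
  have : 2 * q / 3 * ln (Z n) <= 2 * q / 3 * ln n%:R by rewrite ler_wpM2l//; lra.
  by move: Xn k1 k2 l4; move: (`|k| * M) => kk; rewrite /X /k; lra.
have e2 : 0 < e / 2 by rewrite divr_gt0.
have [N4 HN4] := barrier_perturbed cE XS gC e2 ltr01 gd.
exists (1 + ln 2 + `|k| * M), (maxn N N4) => n.
rewrite geq_max => /andP[+ /HN4]; rewrite !geq_max => /and4P[n1 /HN1/andP[Z1 _] _ _].
have := kM n; rewrite ler_norml => /andP[k1 k2].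
have : 2 * q / 3 * (ln n%:R - ln 2) <= 2 * q / 3 * ln (Z n) by rewrite ler_wpM2l//; lra.
have : 2 * q / 3 * ln 2 <= 1 * ln 2 :> R by rewrite ler_wpM2r ?ln_ge0//; lra.
by move: k1 k2; move: (`|k| * M) => kk; rewrite /X /k; lra.
Qed.

Lemma ln_pos_ratio_ballistic : ln `|S n| / ln n%:R @[n --> \oo] --> (1 : R).
Proof.
apply: ln_ratio_cvg => e e0; have [C [N HN]] := ln_pos_lower e0.
have [N' HN'] := pos_sqr_gt0.
exists `|C|, (maxn 1 (maxn N N')) => n; rewrite !geq_max => /and3P[n1 /HN h1 N'n].
have h2 : ln `|S n| <= ln n%:R by apply: ln_pos_le_ln => //; exact: HN'.
have := ler_norm C => ?; have := normr_ge0 C => ?.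
by apply/andP; split; lra.
Qed.

End ballistic_growth.

End path.

(** * Almost every path is regular *)

Section almost_sure.
Context {d} {T : measurableType d} {R : realType} (P : probability T R).
Variables (X : nat -> {RV P >-> R}) (U : 'I_2 -> nat -> {RV P >-> nat})
  (sigma : 'I_2 -> nat -> {RV P >-> R}) (p : R).
Hypotheses (p0 : 0 < p) (p1 : p < 1) (hX : elephant_walk X U sigma p).
Hypothesis p38 : 3 / 8 < 2 * p - 1.
Local Notation q := (2 * p - 1).
Local Notation val := (@val_of R).
Local Notation step := (step X).
Local Notation hist := (hist step).
Local Notation xi f k w := (noise (step_law p) f (hist k w) (step k w)).
Local Notation norm_val := (fun a => `|val a|).

Lemma ae_valid : {ae P, forall w, forall n, (2 <= n)%N -> valid (hist n w)}.
Proof.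
have Nk (k : 'I_2) : {ae P, forall w, step k w != None}.
  exists (step k @^-1` [set None]); split.
  - exact: measurable_step.
  - by rewrite prE ?(pr_first_none hX)//; exact: measurable_step.
  - by move=> w /= /negP; rewrite negbK => /eqP.
apply: filterS2 (Nk 0) (Nk 1) => w h0 h1 n n2.
by rewrite /valid size_hist n2 !nth_hist ?h0// ltnW.
Qed.

Lemma position_hist w n : (forall n, (2 <= n)%N -> valid (hist n w)) ->
  position X n w = pos (hist n w).
Proof.
move=> vw; rewrite /position big_add1 big_mkord posE size_hist.
apply: eq_bigr => -[k kn] _ /=; rewrite nth_hist//.
have sk : (k < size (hist k.+2 w))%N by rewrite size_hist.
have aw : atom step (hist k.+2 w) w by rewrite /atom size_hist.
by rewrite (val_step hX (vw k.+2 isT) aw sk) nth_hist.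
Qed.

Lemma ae_noise (c : seq (option bool) -> R) (beta r : nat -> R) f :
  (forall a, `|f a| <= 1) -> (forall n, (2 <= n)%N -> 0 <= r n) ->
  (forall n, (2 <= n)%N -> 0 <= beta n) ->
  (forall n, (2 <= n)%N -> beta n <= r n - r n.+1) ->
  r n @[n --> \oo] --> (0 : R) ->
  {ae P, forall w, (exists B, \forall n \near \oo, c (hist n w) ^+ 2 <= B * beta n) ->
    cvgn (fun n => \sum_(k < n) c (hist k w) * xi f k w)}.
Proof.
exact: (transform_cvg None (@measurable_step _ _ _ _ X) (chain_rule hX)).
Qed.

Lemma two_div_cvg0 : (2 / n%:R : R) @[n --> \oo] --> (0 : R).
Proof. by rewrite -(mulr0 2); apply: cvgM; [exact: cvg_cst|exact: invn_cvg0]. Qed.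

Lemma ae_noise_inv_sqr (c : seq (option bool) -> R) f : (forall a, `|f a| <= 1) ->
  {ae P, forall w, (exists B, \forall n \near \oo, c (hist n w) ^+ 2 <= B * n%:R^-1 ^+ 2) ->
    cvgn (fun n => \sum_(k < n) c (hist k w) * xi f k w)}.
Proof.
move=> f1; apply: (@ae_noise c _ (fun n => 2 / n%:R)) => //.
- by move=> n n2; apply: sqr_inv_le; exact: ltnW.
- exact: two_div_cvg0.
Qed.

Lemma ae_freq_noise f : (forall a, `|f a| <= 1) ->
  {ae P, forall w, cvgn (freq_noise p (step ^~ w) f)}.
Proof.
move=> f1; apply: filterS (ae_noise_inv_sqr (fun h => (size h).+1%:R^-1) f1) => w H.
have -> : freq_noise p (step ^~ w) f = (fun n =>
    \sum_(k < n) (size (hist k w)).+1%:R^-1 * xi f k w).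
  by apply/funext => n; apply: eq_bigr => k _; rewrite size_hist.
apply: H; exists 1; exists 1%N => // n /= n1; rewrite size_hist mul1r.
by rewrite lerXn2r ?nnegrE ?invr_ge0// lef_pV2 ?posrE ?ltr0n// ler_nat.
Qed.

(** If the frequency of non-zero steps stays below [1 / 3] from some time on, the
    boundedness of the idle potential still keeps it away from 0. *)
Lemma ae_active : {ae P, forall w, exists2 c : R, 0 < c &
  forall N, exists2 n, (N <= n)%N & c <= move_freq (hist n w)}.
Proof.
have bd : {ae P, forall w, forall N, exists B : R, forall n, (N.+2 <= n)%N ->
    idle_potential N.+2 (hist n w) <= B}.
  apply/ae_foralln => N.
  apply: (supermartingale_bounded (@measurable_step _ _ _ _ X) (chain_rule hX)) => //.
    by move=> h; exact: idle_potential_ge0.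
  move=> h Nh ch; have h2 : (2 <= size h)%N by exact: leq_trans Nh.
  by apply: idle_supermartingale => //; apply: (charged_valid hX) ch.
apply: filterS2 bd ae_valid => w bw vw.
have [low|nlow] := pselect (exists N, forall n, (N <= n)%N -> move_freq (hist n w) < 3^-1 :> R);
    last first.
  exists 3^-1 => // N; apply: contrapT => H; apply: nlow; exists N => n Nn.
  by rewrite ltNge; apply/negP => ?; apply: H; exists n.
have [N HN] := low; have [B HB] := bw N.
exists (2 * (`|B| + 1))^-1; first by rewrite invr_gt0 mulr_gt0// ltr_wpDl.
move=> M; exists (maxn M N.+2); first exact: leq_maxl.
set n := maxn M N.+2; have Nn : (N.+2 <= n)%N by exact: leq_maxr.
have n2 : 2 <= n%:R :> R by rewrite ler_nat (leq_trans _ Nn).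
have Z2 := moves_ge2 (R := R) (vw n (leq_trans (isT : (2 <= N.+2)%N) Nn)).
have := HB n Nn; rewrite /idle_potential ifT; last first.
  apply/allP => k; rewrite mem_iota add0n size_hist => /andP[_ kn].
  apply/implyP => Nk; rewrite /low take_hist ?(ltnW kn)//.
  by apply: HN; apply: leq_trans Nk; rewrite !leqW.
rewrite size_hist /move_freq size_hist => h1.
rewrite (_ : n.-1%:R = n%:R - 1) in h1; last first.
  by rewrite -subn1 natrB// (leq_trans _ Nn).
rewrite ler_pdivrMr in h1; last by lra.
rewrite ler_pdivlMr; last by lra.
rewrite ler_pdivrMl; last by rewrite mulr_gt0// ltr_wpDl.
have : B * moves (hist n w) <= `|B| * moves (hist n w).
  by rewrite ler_wpM2r ?ler_norm//; lra.
by lra.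
Qed.

(** Boundedness of the escape potential says that [growth n * n] is at most a
    constant times [K * n + S ^ 2], and the first term is negligible as the
    growth is unbounded. *)
Lemma ae_escaped : {ae P, forall w,
  (exists N, forall n, (N <= n)%N -> outward p (margin p) (hist n w)) ->
  exists2 B : R, 0 < B & exists N, forall n, (N <= n)%N ->
    n%:R * growth (rate p) n <= B * pos (hist n w) ^+ 2}.
Proof.
have m0 := margin_gt0 p38; have r0 := rate_gt0 p38.
pose K : R := 16 / margin p; have K0 : 0 < K by rewrite divr_gt0.
pose N0 := (Num.truncn (8 * (K + 1) ^+ 2)).+2.
have bd : {ae P, forall w, forall N, exists B : R, forall n, (maxn N N0 <= n)%N ->
    escape_potential p (margin p) (maxn N N0) (hist n w) <= B}.
  apply/ae_foralln => N.
  apply: (supermartingale_bounded (@measurable_step _ _ _ _ X) (chain_rule hX)).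
  - by rewrite leq_max orbC.
  - by move=> h; exact: escape_potential_ge0.
  move=> h Nh ch; have h0 : (N0 <= size h)%N by exact: leq_trans (leq_maxr _ _) Nh.
  have h2 : (2 <= size h)%N by exact: leq_trans h0.
  apply: escape_supermartingale => //; first by apply: (charged_valid hX) ch.
  apply: (@le_trans _ _ (Num.truncn (8 * (K + 1) ^+ 2)).+1%:R).
    exact/ltW/truncnS_gt.
  by rewrite ler_nat; apply: leq_trans h0.
apply: filterS bd => w bw [N HN]; have [B HB] := bw N.
pose B' := `|B| + 1; have B'0 : 0 < B' by rewrite ltr_wpDl.
have [M HM] := harm_unbounded ((rate p)^-1 * (2 * B' * K)).
exists (2 * B'); first by rewrite mulr_gt0.
exists (maxn (maxn N N0) M) => n; rewrite geq_max => /andP[Nn Mn].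
have n0 : 0 < n%:R :> R.
  by rewrite ltr0n; apply: leq_trans Nn; rewrite leq_max orbC.
have gn : 2 * B' * K <= growth (rate p) n.
  apply: le_trans (growth_ge_harm n (ltW r0)).
  by rewrite -ler_pdivrMl//; exact: HM.
have := HB n Nn; rewrite /escape_potential ifT; last first.
  apply/allP => k; rewrite mem_iota add0n size_hist => /andP[_ kn].
  apply/implyP => Nk; rewrite take_hist ?(ltnW kn)//.
  by apply: HN; apply: leq_trans Nk; exact: leq_maxl.
rewrite size_hist -/(rate p) -/K mulrA => h1.
have : growth (rate p) n * n%:R / (K * n%:R + pos (hist n w) ^+ 2) <= B'.
  by apply: le_trans h1 _; have := ler_norm B; rewrite /B'; lra.
have D0 : 0 < K * n%:R + pos (hist n w) ^+ 2.
  by rewrite ltr_pwDl ?sqr_ge0// mulr_gt0.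
rewrite ler_pdivrMr// => h2.
have : 2 * B' * K * n%:R <= growth (rate p) n * n%:R by rewrite ler_wpM2r// ltW.
by lra.
Qed.

End almost_sure.

(** * Growth of the walk *)

Section conclusion.
Context {d} {T : measurableType d} {R : realType} (P : probability T R).
Variables (X : nat -> {RV P >-> R}) (U : 'I_2 -> nat -> {RV P >-> nat})
  (sigma : 'I_2 -> nat -> {RV P >-> R}) (p : R).
Hypotheses (p0 : 0 < p) (p1 : p < 1) (hX : elephant_walk X U sigma p).
Hypothesis p38 : 3 / 8 < 2 * p - 1.
Local Notation q := (2 * p - 1).
Local Notation hist := (hist (step X)).

(** On almost every path the four noise series converge: those of the two
    frequency recursions unconditionally, those weighted by [1 / S] and [1 / Z]
    once the escape bound and the lower bound on [z] are available. *)
Lemma ae_path : {ae P, forall w,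
  [/\ `|position X n w| @[n --> \oo] --> +oo,
      q < 3 / 4 -> ln `|position X n w| / ln n%:R @[n --> \oo] --> 4 * q / 3,
      3 / 4 <= q -> ln `|position X n w| / ln n%:R @[n --> \oo] --> (1 : R) &
      q < 3 / 4 -> exists2 L : R, L != 0 &
        position X n w / n%:R `^ (4 * q / 3) @[n --> \oo] --> L]}.
Proof.
have r0 := rate_gt0 p38; have v1 := norm_val_le1 (R := R).
have nv1 a : `| `|val_of a| | <= 1 :> R by rewrite normr_id.
have n3 := @ae_noise _ _ _ _ _ _ _ _ hX (fun h => (pos h)^-1) (escape_weight (rate p))
  (escape_tail (rate p)) _ v1
  (fun n _ => escape_tail_ge0 n r0) (fun n _ => escape_weight_ge0 n (ltW r0))
  (fun n n2 => escape_weight_le r0 (ltnW n2)) (escape_tail_cvg0 r0).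
have n4 := ae_noise_inv_sqr hX (fun h => (moves h)^-1) nv1.
have conj (A B : T -> Prop) : {ae P, forall w, A w} -> {ae P, forall w, B w} ->
    {ae P, forall w, A w /\ B w} by move=> a b; apply: filterS2 a b => w.
have regular := conj _ _ (ae_valid hX) (conj _ _ (ae_active hX)
  (conj _ _ (ae_escaped p0 p1 hX p38) (conj _ _ n3 n4))).
apply: filterS3 regular (ae_freq_noise hX v1) (ae_freq_noise hX nv1).
move=> w [vw [aw [ew [nw3 nw4]]]] cv cn.
have out := eventually_outward p0 p1 p38 cv cn aw.
have esc := ew out.
have cp : cvgn (fun n => \sum_(k < n) (pos (hist k w))^-1 *
    noise (step_law p) val_of (hist k w) (step X k w)).
  apply: nw3; have [B B0 [N HN]] := esc; exists B.
  exists (maxn 1 N) => // n /=; rewrite geq_max => /andP[n1 Nn].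
  have G0 : 0 < n%:R * growth (rate p) n.
    by rewrite mulr_gt0 ?ltr0n// (lt_le_trans ltr01)// growth_ge1// ltW.
  have S0 : 0 < pos (hist n w) ^+ 2 :> R.
    by rewrite -(pmulr_rgt0 _ B0); apply: lt_le_trans (HN _ Nn).
  by rewrite exprVn /escape_weight ler_pdivlMr// mulrC ler_pdivrMr// HN.
have cm : cvgn (fun n => \sum_(k < n) (moves (hist k w))^-1 *
    noise (step_law p) (fun a => `|val_of a|) (hist k w) (step X k w)).
  apply: nw4; have [N HN] := move_freq_ge_half p0 p1 cn aw.
  exists 4; exists (maxn 1 N) => // n /=; rewrite geq_max => /andP[n1 Nn].
  have n0 : 0 < n%:R :> R by rewrite ltr0n.
  have Zn : 2^-1 * n%:R <= moves (hist n w) :> R.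
    by rewrite [leRHS](path_size_moves (step X ^~ w)) ler_wpM2r// HN.
  rewrite (_ : 4 * _ = (2 * n%:R^-1) ^+ 2); last by rewrite exprMn [in RHS]expr2; lra.
  rewrite lerXn2r ?nnegrE ?invr_ge0 ?moves_ge0 ?mulr_ge0 ?invr_ge0//.
  rewrite -[leRHS]invrK lef_pV2 ?posrE ?invr_gt0 ?mulr_gt0 ?invr_gt0//; last first.
    by rewrite (lt_le_trans _ Zn)// mulr_gt0.
  by rewrite invfM invrK.
have pE : (fun n => position X n w) = (fun n => pos (hist n w)).
  by apply/funext => n; exact: position_hist hX _ _ _.
have -> : (fun n => position X n w / n%:R `^ (4 * q / 3)) =
    (fun n => pos (hist n w) / n%:R `^ (4 * q / 3)).
  by apply/funext => n; rewrite (position_hist hX).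
have -> : (fun n => ln `|position X n w| / ln n%:R) =
    (fun n => ln `|pos (hist n w)| / ln n%:R).
  by apply/funext => n; rewrite (position_hist hX).
have -> : (fun n => `|position X n w|) = (fun n => `|pos (hist n w)|).
  by apply/funext => n; rewrite (position_hist hX).
split.
- exact: (norm_pos_cvgy p38 esc).
- move=> q34; exact: (ln_pos_ratio_subballistic p0 p1 p38 cv cn aw esc cp cm q34).
- move=> q34; exact: (ln_pos_ratio_ballistic p0 p1 p38 cn aw esc cp cm q34).
- move=> q34; exact: (pos_scale_cvg p0 p1 p38 cv cn aw esc cp cm q34).
Qed.

Lemma measurable_position n : measurable_fun setT (position X n).
Proof.
apply: measurable_sum => j; exact: measurable_funP.
Qed.

End conclusion.

Theorem theorem1p2 (d : measure_display) (T : measurableType d) (R : realType)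
    (P : probability T R) (X : nat -> {RV P >-> R})
    (U : 'I_2 -> nat -> {RV P >-> nat}) (sigma : 'I_2 -> nat -> {RV P >-> R})
    (p : R) (hp0 : 0 < p) (hp1 : p < 1) (hX : elephant_walk X U sigma p) :
  (11 / 16 < p ->
     {ae P, forall w, `|position X n w| @[n --> \oo] --> +oo} /\
     {ae P, forall w, ln `|position X n w| / ln n%:R @[n --> \oo] -->
                      Num.min ((8 * p - 4) / 3) 1}) /\
  (11 / 16 < p -> p < 7 / 8 ->
     exists L : {RV P >-> R},
       {ae P, forall w, position X n w / n%:R `^ ((8 * p - 4) / 3)
                        @[n --> \oo] --> L w} /\
       P (L @^-1` [set 0]) = 0%E).
Proof.
have aE : (8 * p - 4) / 3 = 4 * (2 * p - 1) / 3 by lra.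
split=> [p16|p16 p78]; have q38 : 3 / 8 < 2 * p - 1 by lra.
all: have path := ae_path hp0 hp1 hX q38.
  split; apply: filterS path => w [h1 h2 h3 _] //.
  have [q34|q34] := ltP (2 * p - 1) (3 / 4).
    by rewrite min_l ?aE; [exact: h2|lra].
  by rewrite min_r; [exact: h3|lra].
have q34 : 2 * p - 1 < 3 / 4 by lra.
pose u n w : R := position X n w / n%:R `^ ((8 * p - 4) / 3).
(* the upper limit is measurable everywhere and is the limit wherever there is one *)
pose L0 w : R := fine (limn_esup (fun n => (u n w)%:E)).
have mL : measurable_fun setT L0.
  apply: (measurableT_comp (fine_measurable measurableT)).
  apply: measurable_fun_limn_esup => n; apply/measurable_EFinP.
  by apply: measurable_funM => //; exact: measurable_position.
pose L : {RV P >-> R} := mfun_Sub (mem_set mL).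
have LE w (l : R) : u n w @[n --> \oo] --> l -> L w = l.
  move=> ul; rewrite /L /= /L0.
  have : (u n w)%:E @[n --> \oo] --> l%:E by apply: cvg_EFin ul; apply: nearW.
  by move=> /cvg_limn_einf_sup[_ ->].
exists L; split.
  apply: filterS path => w [_ _ _ /(_ q34)[l _]]; rewrite -aE => ul.
  by rewrite (LE w l).
have : P.-negligible (L @^-1` [set 0]).
  apply: negligibleS path => w Lw [_ _ _ /(_ q34)[l l0]]; rewrite -aE => ul.
  by move: l0; rewrite -(LE w l ul) (Lw : L w = 0) eqxx.
move=> /negligibleP; apply; rewrite -[X in measurable X]setTI.
exact: measurable_funP.
Qed.
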